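(* Let $\mathcal C\subset\mathbb V^{d+1}$ be a proper open convex cone and let $K$ be a convex domain in $\mathbb A^{d+1}$ with $C^2$ boundary. If $\partial K$ has constant $\mathcal C$-curvature $\kappa>0$, then it has constant affine Gaussian curvature $\kappa^{2(d+1)/(d+2)}$.
   Context: Setting: $d\ge2$; $\mathbb V^{d+1}$ is an oriented $(d+1)$-dimensional real vector space with a linear volume form; $\mathbb A^{d+1}$ is the real affine space with translation space $\mathbb V^{d+1}$, with the induced parallel volume form and flat connection $D$. A convex cone is proper if it is non-empty and its closure contains no entire line. $\mathcal C^*=\mathrm{int}\{\varphi\in(\mathbb V^{d+1})^*:\varphi(v)\le0\ \forall v\in\mathcal C\}$; a point $[\varphi]\in\mathbb P(\mathcal C^* )$ is identified with $\ker\varphi$, regarded as a direction of affine hyperplanes. A convex domain is a non-empty open convex set; a supporting hyperplane of it is an affine hyperplane $H$ with $H\cap K=\emptyset$, $H\cap\partial K\ne\emptyset$. A $\mathcal C$-convex domain is a convex domain $K$ with $K+\mathcal C=K$ whose set of directions of supporting hyperplanes contains $\mathbb P(\mathcal C^* )$ and is contained in $\overline{\mathbb P(\mathcal C^* )}$. It is $C^2_+$ if $\partial K$ is $C^2$ and locally the graph of a convex function with non-degenerate Hessian; then every tangent hyperplane has direction in $\mathbb P(\mathcal C^* )$ and the Gauss map $\mathcal G_K:\partial K\to\mathbb P(\mathcal C^* )$ (direction of the tangent hyperplane) is a $C^1$ diffeomorphism. Affine sphere: choose coordinates (origin and positively oriented unit-volume basis) in which $\mathcal C=\{t(x,1):x\in\Omega,t>0\}$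 with $\Omega\subset\mathbb R^d$ bounded open convex containing $0$; then $\mathcal C^*=\{t(y,-1):y\in\Omega^*,t>0\}$ with $\Omega^*=\{y:x\cdot y<1\ \forall x\in\overline\Omega\}$ and $\mathbb P(\mathcal C^* )\simeq\Omega^*$. Let $\omega_{\mathcal C}:\Omega^*\to(-\infty,0)$ be the unique smooth convex function with $\det\mathrm{Hess}\,\omega=(-\omega)^{-d-2}$ in $\Omega^*$, $\omega|_{\partial\Omega^*}=0$. The map $N_{\Sigma_{\mathcal C}}(y)=(\nabla\omega_{\mathcal C}(y),\nabla\omega_{\mathcal C}(y)\cdot y-\omega_{\mathcal C}(y))$ parametrises the Cheng--Yau affine sphere $\Sigma_{\mathcal C}\subset\mathbb V^{d+1}$ (independent of choices), and $N_{\Sigma_{\mathcal C}}[\varphi]$ is the vector of $\Sigma_{\mathcal C}$ where the tangent hyperplane has direction $[\varphi]$. $\mathcal C$-curvature: for a $C^2_+$ $\mathcal C$-convex domain $K$ let $N=N_{\Sigma_{\mathcal C}}\circ\mathcal G_K:\partial K\to\Sigma_{\mathcal C}$. At $P\in\partial K$ its differential is an endomorphism of the linear hyperplane directing $T_P\partial K$, and the $\mathcal C$-curvature at $P$ is its determinant. ''$\partial K$ has constant $\mathcal C$-curvature $\kappa$'' means that $K$ is a $C^2_+$ $\mathcal C$-convex domain and this determinant equals $\kappa$ everywhere. Affine Gaussian curvature: for a locally uniformly convex hypersurface $S$ of $\mathbb A^{d+1}$ (sufficiently regular), the Blaschke normal is the unique transverse vector field $\xi$, pointing to the convex side, such that,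 writing $D_XY=\nabla_XY+h(X,Y)\xi$ with $\nabla_XY$ tangent, $D_X\xi=B(X)$ is tangent to $S$ for all tangent $X$, and the volume form $\mathrm{vol}(\cdot,\dots,\cdot,\xi)$ on $S$ coincides (up to sign) with the volume form of the metric $h$. The affine Gaussian curvature is $\det B$. ''Constant affine Gaussian curvature $k$'' means $\xi$ is defined and $\det B\equiv k$. *)

(* Defs.v *)
(* MathComp-Analysis.

   The oriented vector space with volume form, and the affine space over it,
   are R^(d+1) = 'rV[R]_(d + 1) with the determinant: vectors and points are
   rows, linear forms are columns, and a linear map v |-> v *m L is its matrix
   L.  Derivatives of vector-valued maps for the flat connection D are thus
   ordinary derivatives.  Neither the cone nor the convex domain is assumed to
   be in any special position with respect to the standard basis. *)
From HB Require Import structures.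
From mathcomp Require Import all_boot all_order all_algebra.
From mathcomp Require Import all_classical all_reals all_analysis.
Import numFieldNormedType.Exports.
Import Order.TTheory GRing.Theory Num.Theory.

Set Implicit Arguments.
Unset Strict Implicit.
Unset Printing Implicit Defensive.

Local Open Scope classical_set_scope.
Local Open Scope ring_scope.

Section Calculus.
Context {R : realType} {d : nat}.
Implicit Types (U : set 'rV[R]_d) (f : 'rV[R]_d -> R).

Definition dot (x y : 'rV[R]_d) : R := (x *m y^T) 0 0.

(* f is of class C^k on U; meant for open U, as 'D_v f x is a derivative in
   the whole space. *)
Fixpoint class_C (k : nat) U f : Prop :=
  if k is k'.+1 then
    (forall x, U x -> differentiable f x) /\
    (forall v : 'rV[R]_d, class_C k' U (fun x => 'D_v f x))
  else forall x, U x -> {for x, continuous f}.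

Definition smooth_on U f : Prop := forall k, class_C k U f.

Definition grad f (x : 'rV[R]_d) : 'rV[R]_d :=
  \row_i 'D_(delta_mx 0 i) f x.

Definition hessian f (x : 'rV[R]_d) : 'M[R]_d :=
  \matrix_(i, j) 'D_(delta_mx 0 i) (fun y => 'D_(delta_mx 0 j) f y) x.

End Calculus.

Definition boundary {T : topologicalType} (A : set T) : set T :=
  closure A `\` A°.

Section Hypersurfaces.
Context {R : realType} {d : nat}.
Local Notation V := 'rV[R]_(d + 1).
Implicit Types (S K : set V) (P : V) (xi : V -> V).

(* Near P, S is the graph { P + (x, f x) | x in U } in the frame given by the
   rows of A. *)
Definition graph_at S P (A : 'M[R]_(d + 1)) (U : set 'rV[R]_d)
    (f : 'rV[R]_d -> R) : Prop :=
  [/\ A \in unitmx, open U, U 0 &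
   exists W : set V, [/\ open W, W P &
     S `&` W = [set P + row_mx x (f x)%:M *m A | x in U]]].

Definition C2_hypersurface S : Prop :=
  forall P, S P -> exists A U f, graph_at S P A U f /\ class_C 2 U f.

Definition locally_uniformly_convex S : Prop :=
  forall P, S P -> exists A U f,
    [/\ graph_at S P A U f, class_C 2 U f, convex_set U, convex_function U f &
        forall x, U x -> \det (hessian f x) != 0].

(* The linear tangent space of S at P: velocities at P of curves in S. *)
Definition tangent S P : set V :=
  [set v | exists g : R -> V,
    [/\ g 0 = P, (\forall t \near 0, S (g t)) & is_derive (0 : R) 1 g v]].

Definition tangent_frame S P (E : 'M[R]_(d, d + 1)) : Prop :=
  row_free E /\ tangent S P = [set v : V | (v <= E)%MS].

(* The map F, of which only the values on S matter, has at P along S the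
   differential v |-> v *m L.  Only the restriction of this linear map to
   tangent S P is determined by F. *)
Definition diff_along S (F : V -> V) P (L : 'M[R]_(d + 1)) : Prop :=
  (fun Q => F Q - F P - (Q - P) *m L) =o_ (within S (nbhs P)) (fun Q => Q - P).

(* The differential of F along S at P maps the tangent hyperplane to itself,
   and k is the determinant of this endomorphism; M is its matrix in the
   tangent basis E. *)
Definition tangential_det S (F : V -> V) P (k : R) : Prop :=
  exists L E (M : 'M[R]_d),
    [/\ diff_along S F P L, tangent_frame S P E, E *m L = M *m E & \det M = k].

(* H represents on tangent S P the bilinear form h of the decomposition
   D_X Y = nabla_X Y + h(X, Y) xi, with nabla_X Y tangent, for X tangent at P
   and Y a tangent vector field. *)
Definition second_form S xi P (H : 'M[R]_(d + 1)) : Prop :=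
  forall (Y : V -> V) (L : 'M[R]_(d + 1)),
    (forall Q, S Q -> tangent S Q (Y Q)) -> diff_along S Y P L ->
    forall X, tangent S P X ->
      tangent S P (X *m L - (X *m H *m (Y P)^T) 0 0 *: xi P).

(* Blaschke normal of boundary K, pointing into K.  The last clause equates
   |vol(X_1, .., X_d, xi)| with the volume form of h, on all tangent bases.
   When boundary K is locally uniformly convex, these conditions determine xi
   on boundary K. *)
Definition blaschke_normal K xi : Prop :=
  let S := boundary K in
  forall P, S P ->
    [/\ ~ tangent S P (xi P),
        (\forall t \near 0^'+, K (P + t *: xi P)),
        (exists L, diff_along S xi P L /\
           forall X, tangent S P X -> tangent S P (X *m L)) &
        exists H, second_form S xi P H /\
          forall E, tangent_frame S P E ->
            `|\det (col_mx E (xi P))| = Num.sqrt (\det (E *m H *m E^T))].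

Definition constant_affine_gauss_curvature K (k : R) : Prop :=
  locally_uniformly_convex (boundary K) /\
  exists xi, blaschke_normal K xi /\
    forall P, boundary K P -> tangential_det (boundary K) xi P k.

End Hypersurfaces.

Section ConvexDomains.
Context {R : realType} {d : nat}.
Local Notation V := 'rV[R]_(d + 1).
Local Notation "V^*" := 'cV[R]_(d + 1).
Implicit Types (C K : set V).

Definition pairing (v : V) (phi : V^*) : R := (v *m phi) 0 0.

Definition convex_cone C : Prop :=
  convex_set C /\ forall v t, C v -> 0 < t -> C (t *: v).

Definition proper_cone C : Prop :=
  C !=set0 /\
  ~ exists p v : V, v != 0 /\ forall t : R, closure C (p + t *: v).

Definition dual_cone C : set V^* :=
  [set phi | forall v, C v -> pairing v phi <= 0]°.

Definition convex_domain K : Prop := [/\ K !=set0, open K & convex_set K].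

(* The nonzero form phi directs a supporting affine hyperplane
   { x | phi x = c } of K. *)
Definition supporting_direction K (phi : V^*) : Prop :=
  phi != 0 /\ exists c : R,
    (forall x, K x -> pairing x phi != c) /\
    (exists x, boundary K x /\ pairing x phi = c).

(* Subsets of the projective space of V^* are handled as sets of nonzero forms
   invariant under nonzero scaling; the quotient map being open, the closure
   of P(C^* ) is computed on such sets. *)
Definition proj_dual_cone C : set V^* :=
  [set phi | exists t : R, t != 0 /\ dual_cone C (t *: phi)].

Definition C_convex_domain C K : Prop :=
  [/\ convex_domain K,
      [set x + v | x in K & v in C] = K,
      (forall phi, phi != 0 -> proj_dual_cone C phi ->
         supporting_direction K phi) &
      (forall phi, supporting_direction K phi ->
         closure (proj_dual_cone C) phi)].

End ConvexDomains.

Section AffineSphere.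
Context {R : realType} {d : nat}.
Local Notation V := 'rV[R]_(d + 1).
Implicit Types (C K S : set V) (Omega : set 'rV[R]_d) (A : 'M[R]_(d + 1)).

(* In the positively oriented unit-volume basis made of the rows of A, C is
   the cone over Omega. *)
Definition cone_coordinates C A Omega : Prop :=
  [/\ \det A = 1,
      [/\ open Omega, convex_set Omega, bounded_set Omega & Omega 0] &
      C = [set v | exists x t,
             [/\ Omega x, 0 < t & v = t *: (row_mx x 1%:M *m A)]]].

Definition dual_domain Omega : set 'rV[R]_d :=
  [set y | forall x, closure Omega x -> dot x y < 1].

(* The linear form with coordinates (y, -1) in the basis dual to the rows
   of A. *)
Definition covector A (y : 'rV[R]_d) : 'cV[R]_(d + 1) :=
  invmx A *m (row_mx y (- 1)%:M)^T.

Definition cheng_yau_solution Omega (omega : 'rV[R]_d -> R) : Prop :=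
  let Omega' := dual_domain Omega in
  [/\ smooth_on Omega' omega, convex_function Omega' omega,
      (forall y, Omega' y -> omega y < 0),
      (forall y, Omega' y ->
         \det (hessian omega y) = (- omega y) ^- (d + 2)) &
      (forall z, boundary Omega' z ->
         omega y @[y --> within Omega' (nbhs z)] --> 0)].

Definition affine_sphere_map A (omega : 'rV[R]_d -> R) (y : 'rV[R]_d) : V :=
  row_mx (grad omega y) (dot (grad omega y) y - omega y)%:M *m A.

(* Gauss map of boundary K, with P(C^* ) identified with the dual domain:
   gauss_map A Omega K P is the y such that the tangent hyperplane at P is the
   kernel of covector A y. *)
Definition gauss_map A Omega K (P : V) : 'rV[R]_d :=
  get [set y | dual_domain Omega y /\
    tangent (boundary K) P = [set v | pairing v (covector A y) = 0]].

(* Existence and uniqueness of omega (Cheng-Yau), and the independence of the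
   affine sphere of the coordinates, make the existential quantifier over
   (A, Omega, omega) equivalent to a fixed choice of them. *)
Definition constant_C_curvature C K (kappa : R) : Prop :=
  [/\ locally_uniformly_convex (boundary K), C_convex_domain C K &
      exists A Omega omega,
        [/\ cone_coordinates C A Omega, cheng_yau_solution Omega omega &
            forall P, boundary K P ->
              tangential_det (boundary K)
                (affine_sphere_map A omega \o gauss_map A Omega K) P kappa]].

End AffineSphere.

(* Main.v *)
(* The affine normal of boundary K is a constant multiple c N of the map N
   sending a point P to the point of the Cheng-Yau affine sphere whose tangent
   hyperplane is parallel to that of P.  Write y for the Gauss map, E0 for the
   frame (1, y^T) of the tangent hyperplane, and let dy and h be the matrices in
   E0 of the differential of y and of the second form relative to c N.  Then:
   - dN = dy * Hess omega is tangential, so that c N is equiaffine, and the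
     Monge-Ampere equation turns det dN = kappa into
     det dy = kappa (- omega)^(d + 2);
   - differentiating <Y, (y, -1)> = 0 for tangent fields Y gives
     h = dy / (- c omega), hence det h = kappa omega^2 / c^d;
   - vol(E0, c N) = - c omega.
   The volume condition is therefore c^(d + 2) = kappa, and the affine Gaussian
   curvature is c^d kappa = kappa^(2 (d + 1) / (d + 2)).

   It remains to see that the Gauss map takes its values in the open set
   P(C^* ): tangent hyperplanes support K, so their directions lie in the
   closure, and the Gauss map is open. *)
Require Import Defs.
From mathcomp Require Import all_boot all_order all_algebra.
From mathcomp Require Import all_classical all_reals all_analysis.
Import numFieldNormedType.Exports.
Import Order.TTheory GRing.Theory Num.Theory.
Local Open Scope classical_set_scope.
Local Open Scope ring_scope.

Set Implicit Arguments.
Unset Strict Implicit.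
Unset Printing Implicit Defensive.

(** * Convexity in terms of real coefficients *)

Section Convexity.
Context {R : realType}.

Lemma convex_setE (V : lmodType R) (A : set V) x y (t : R) :
  convex_set A -> A x -> A y -> 0 <= t <= 1 -> A (t *: x + (1 - t) *: y).
Proof.
move=> cA Ax Ay /andP[t0 t1]; have := cA x y (Itv01 t0 t1).
by rewrite !inE; apply.
Qed.

Lemma convex_functionE (V : lmodType R) (A : set V) (f : V -> R) x y (t : R) :
  convex_function A f -> A x -> A y -> 0 <= t <= 1 ->
  f (t *: x + (1 - t) *: y) <= t * f x + (1 - t) * f y.
Proof.
move=> cf Ax Ay /andP[t0 t1]; have := cf (Itv01 t0 t1) x y.
by rewrite !inE; apply.
Qed.

End Convexity.

(** * One-sided derivatives and derivatives along curves *)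

Section Derivatives.
Context {R : realType}.
Implicit Types V W : normedModType R.

(** Once the derivative exists, its value can be read off from t > 0 alone. Convexity and minimality
    arguments only control a function on that side. *)
Lemma derive_at_right V W (f : V -> W) a v : derivable f a v ->
  (fun t : R => t^-1 *: (f (t *: v + a) - f a)) @ 0^'+ --> 'D_v f a.
Proof. by move=> df; apply: cvg_dnbhs_at_right. Qed.

Lemma derive_at_right_eq0 V W (f : V -> W) a v : derivable f a v ->
  (\forall t \near (0 : R)^'+, f (t *: v + a) = f a) -> 'D_v f a = 0.
Proof.
move=> /derive_at_right df fa; apply/esym/(cvg_unique _ _ df) => //.
apply: cvg_near_cst; near=> t; rewrite (near fa t)// subrr scaler0 //.
Unshelve. all: by end_near. Qed.

Lemma derive_at_right_ge0 V (f : V -> R) a v : derivable f a v ->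
  (\forall t \near (0 : R)^'+, f a <= f (t *: v + a)) -> 0 <= 'D_v f a.
Proof.
move=> /derive_at_right df fa.
rewrite -(cvg_lim (@Rhausdorff R) df); apply: limr_ge; first exact: cvgP df.
near=> t; rewrite [leRHS](_ : _ = t^-1 * (f (t *: v + a) - f a))//.
by rewrite mulr_ge0 ?invr_ge0// subr_ge0 (near fa t).
Unshelve. all: by end_near. Qed.

(** The derivatives along v and - v are both nonnegative, and they are opposite by linearity of the
    differential. *)
Lemma derive_local_min V (f : V -> R) a v : differentiable f a ->
  (\forall x \near a, f a <= f x) -> 'D_v f a = 0.
Proof.
move=> df fa.
have H w : 0 <= 'D_w f a.
  apply: derive_at_right_ge0; first exact: diff_derivable.
  have cw : (fun t : R => t *: w + a) @ (0 : R)^'+ --> a.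
    apply: cvg_at_right_filter; rewrite -[X in _ --> X]add0r -(scale0r w).
    by apply: cvgD; [apply: cvgZl; exact: cvg_id | exact: cvg_cst].
  exact: cw _ fa.
apply/eqP; rewrite eq_le H andbT -oppr_ge0.
have := H (- v); by rewrite !deriveE // linearN.
Qed.

Lemma is_derive_comp_diff V W (f : V -> W) (g : R -> V) (t : R) v :
  differentiable f (g t) -> is_derive t 1 g v ->
  is_derive t 1 (f \o g) ('D_v f (g t)).
Proof.
move=> df [dg <-].
have dg' : differentiable g t by apply/derivable1_diffP.
apply: DeriveDef; first by apply/derivable1_diffP/differentiable_comp.
by rewrite !deriveE //; [rewrite diff_comp | exact: differentiable_comp].
Qed.

Lemma is_derive1_cvg V (g : R -> V) v :
  is_derive (0 : R) 1 g v <-> (fun h : R => h^-1 *: (g h - g 0)) @ 0^' --> v.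
Proof.
have E : (fun h : R => h^-1 *: ((g \o shift 0) (h *: 1) - g 0)) =
    (fun h : R => h^-1 *: (g h - g 0)).
  by apply/funext => h /=; rewrite addr0 [h *: _]mulr1.
split=> [[dg <-]|gv]; first by rewrite -E.
apply: DeriveDef; first by apply/cvg_ex; exists v; rewrite E.
by apply/cvg_lim => //; rewrite E.
Qed.

Lemma differentiable_fun_sum V W n (h : 'I_n -> V -> W) x :
  (forall i, differentiable (h i) x) ->
  differentiable (fun y => \sum_i h i y) x.
Proof.
move=> dh; rewrite (_ : (fun y => _) = \sum_i h i); first exact: differentiable_sum.
by apply/funext => y; rewrite fct_sumE.
Qed.

Lemma is_derive_fun_sum V W n (h : 'I_n -> V -> W) x v dh :
  (forall i, is_derive x v (h i) (dh i)) ->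
  is_derive x v (fun y => \sum_i h i y) (\sum_i dh i).
Proof.
move=> H; rewrite (_ : (fun y => _) = \sum_i h i); first exact: is_derive_sum.
by apply/funext => y; rewrite fct_sumE.
Qed.

Lemma is_derive_continuous V (g : R -> V) (t : R) v :
  is_derive t 1 g v -> {for t, continuous g}.
Proof. by move=> [dg _]; apply/differentiable_continuous/derivable1_diffP. Qed.

Lemma near_curve V (g : R -> V) v (A : set V) :
  is_derive (0 : R) 1 g v -> nbhs (g 0) A -> \forall t \near (0 : R), A (g t).
Proof. by move=> /is_derive_continuous cg; exact: cg. Qed.

End Derivatives.

(** * Calculus of row vectors, the dot product and linear maps *)

Section RowVectors.
Context {R : realType}.

Lemma differentiable_mxE (V : normedModType R) m n (f : V -> 'M[R]_(m, n)) x :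
  (forall i j, differentiable (fun y => f y i j) x) -> differentiable f x.
Proof.
move=> df; rewrite (_ : f = fun y => \sum_i \sum_j f y i j *: delta_mx i j).
  apply: differentiable_fun_sum => i; apply: differentiable_fun_sum => j.
  exact: differentiableZl.
by apply/funext => y; exact: matrix_sum_delta.
Qed.

Lemma differentiable_rowE (V : normedModType R) n (f : V -> 'rV[R]_n) x :
  (forall i, differentiable (fun y => f y 0 i) x) -> differentiable f x.
Proof. by move=> df; apply: differentiable_mxE => i j; rewrite ord1. Qed.

Lemma dotE n (x y : 'rV[R]_n) : dot x y = \sum_i x 0 i * y 0 i.
Proof. by rewrite /dot mxE; apply: eq_bigr => i _; rewrite mxE. Qed.

Lemma dotC n (x y : 'rV[R]_n) : dot x y = dot y x.
Proof. by rewrite !dotE; apply: eq_bigr => i _; rewrite mulrC. Qed.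

Lemma dotDl n (x y z : 'rV[R]_n) : dot (x + y) z = dot x z + dot y z.
Proof. by rewrite /dot mulmxDl mxE. Qed.

Lemma dotNl n (x z : 'rV[R]_n) : dot (- x) z = - dot x z.
Proof. by rewrite /dot mulNmx mxE. Qed.

Lemma dotZl n (a : R) (x z : 'rV[R]_n) : dot (a *: x) z = a * dot x z.
Proof. by rewrite /dot -scalemxAl mxE. Qed.

Lemma dotBr n (x y z : 'rV[R]_n) : dot x (y - z) = dot x y - dot x z.
Proof. by rewrite dotC dotDl dotNl !(dotC x). Qed.

(** The norm of a row is the sup norm, whence the factor n. *)
Lemma dot_bound n (x y : 'rV[R]_n) : `|dot x y| <= n%:R * (`|x| * `|y|).
Proof.
rewrite dotE (le_trans (ler_norm_sum _ _ _))//.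
have H (z : 'rV[R]_n) i : `|z 0 i| <= `|z|.
  rewrite [leRHS]/Num.Def.normr/= mx_normrE.
  exact: (le_bigmax _ (fun i => `|z i.1 i.2|) (0, i)).
rewrite (@le_trans _ _ (\sum_(i < n) `|x| * `|y|))//.
  by apply: ler_sum => i _; rewrite normrM ler_pM.
by rewrite sumr_const card_ord mulr_natl.
Qed.

Lemma differentiable_dotl n (p x : 'rV[R]_n) : differentiable (fun y => dot y p) x.
Proof.
rewrite (_ : (fun y => dot y p) = fun y => \sum_i y 0 i * p 0 i); last first.
  by apply/funext => y; rewrite dotE.
apply: differentiable_fun_sum => i; apply: differentiableM; last first.
  exact: differentiable_cst.
exact: differentiable_coord.
Qed.

Lemma derive_dotl n (p x v : 'rV[R]_n) : 'D_v (fun y => dot y p) x = dot v p.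
Proof.
apply/cvg_lim => //; apply: cvg_near_cst; near=> h.
rewrite /= dotDl addrK dotZl [LHS]mulrA mulVf ?mul1r//.
near: h; exact: nbhs_dnbhs_neq.
Unshelve. all: by end_near. Qed.

Lemma mulmxr_continuous n p (L : 'M[R]_(n, p)) :
  continuous (mulmxr L : 'rV[R]_n -> 'rV[R]_p).
Proof.
move=> v; apply: differentiable_continuous; apply: differentiable_rowE => i.
rewrite (_ : (fun y => _) = fun y => dot y (col i L)^T).
  exact: differentiable_dotl.
by apply/funext => y; rewrite /dot trmxK !mxE; apply: eq_bigr => j _; rewrite mxE.
Qed.

Lemma is_diff_mulmxr n p (L : 'M[R]_(n, p)) (v : 'rV[R]_n) :
  is_diff v (fun w => w *m L) (fun w => w *m L).
Proof.
apply: (@DiffDef _ _ _ _ _ (mulmxr L)).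
  exact: linear_differentiable (@mulmxr_continuous _ _ L).
exact: diff_lin (@mulmxr_continuous _ _ L).
Qed.

Lemma is_derive_mulmxr n p (L : 'M[R]_(n, p)) (g : R -> 'rV[R]_n) (t : R) v :
  is_derive t 1 g v -> is_derive t 1 (fun s => g s *m L) (v *m L).
Proof.
have [df dE] := is_diff_mulmxr L (g t).
move=> /(is_derive_comp_diff df); rewrite deriveE //.
by rewrite (_ : 'd _ _ v = v *m L) // dE.
Qed.

Lemma is_derive_coord n (g : R -> 'rV[R]_n) (t : R) v i :
  is_derive t 1 g v -> is_derive t 1 (fun s => g s 0 i) (v 0 i).
Proof.
move=> [dg <-]; rewrite derive_mx // mxE.
by apply: DeriveDef => //; move/derivable_mxP: dg.
Qed.

Lemma is_derive_row n (g : R -> 'rV[R]_n) (t : R) (v : 'rV[R]_n) :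
  (forall i, is_derive t 1 (fun s => g s 0 i) (v 0 i)) -> is_derive t 1 g v.
Proof.
move=> H; have dg : derivable g t 1.
  by apply/derivable_mxP => i j; rewrite ord1; have [] := H j.
apply: DeriveDef => //; rewrite derive_mx//; apply/rowP => j; rewrite mxE.
by have [_ ->] := H j.
Qed.

Lemma is_derive_dot n (g1 g2 : R -> 'rV[R]_n) (t : R) v1 v2 :
  is_derive t 1 g1 v1 -> is_derive t 1 g2 v2 ->
  is_derive t 1 (fun s => dot (g1 s) (g2 s)) (dot v1 (g2 t) + dot (g1 t) v2).
Proof.
move=> d1 d2.
rewrite (_ : (fun s => _) = fun s => \sum_i g1 s 0 i * g2 s 0 i); last first.
  by apply/funext => s; rewrite dotE.
have D i : is_derive t 1 (fun s => g1 s 0 i * g2 s 0 i)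
    (g1 t 0 i *: v2 0 i + g2 t 0 i *: v1 0 i).
  exact: (is_deriveM (is_derive_coord i d1) (is_derive_coord i d2)).
apply: is_derive_eq; first
  exact: (is_derive_fun_sum D).
rewrite !dotE -big_split /=; apply: eq_bigr => i _.
by rewrite addrC; congr (_ + _); exact: mulrC.
Qed.

End RowVectors.

(** * Differentials along a subset, tested on curves *)

Section Along.
Context {R : realType} {d : nat}.
Local Notation V := 'rV[R]_(d + 1).

(** The remainder is small relative to [g h - g 0], which is itself O(h). Since S only determines L
    on tangent vectors, curves are the way to compare two expressions of the same differential. *)
Lemma diff_along_curve (S : set V) (F : V -> V) (L : 'M[R]_(d + 1)) g v :
  diff_along S F (g 0) L -> (\forall t \near (0 : R), S (g t)) ->
  is_derive (0 : R) 1 g v -> is_derive (0 : R) 1 (F \o g) (v *m L).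
Proof.
move=> /eqoP FL Sg dg; apply/is_derive1_cvg.
have /is_derive1_cvg gL := is_derive_mulmxr L dg.
have /is_derive1_cvg gv := dg.
rewrite -[v *m L]addr0.
pose e Q := F Q - F (g 0) - (Q - g 0) *m L.
have -> : (fun h : R => h^-1 *: ((F \o g) h - (F \o g) 0)) =
    (fun h : R => h^-1 *: (g h *m L - g 0 *m L)) \+ (fun h : R => h^-1 *: e (g h)).
  apply/funext => h /=; rewrite -scalerDr /e; congr (_ *: _).
  by rewrite mulmxBl [RHS]addrC subrK.
apply: cvgD => //; apply/cvgrPdist_le => eps eps0.
have eps1 : 0 < eps / (`|v| + 1) by rewrite divr_gt0// ltr_wpDl.
have H := near_curve dg (FL _ eps1).
have B : \forall h \near 0^', `|h^-1 *: (g h - g 0)| <= `|v| + 1.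
  by apply: (cvgr_norm_le _ gv); rewrite ltrDl.
have H' := nbhs_dnbhs H; have Sg' := nbhs_dnbhs Sg.
near=> h.
rewrite sub0r normrN normrZ.
have He : `|e (g h)| <= eps / (`|v| + 1) * `|g h - g 0|.
  by apply: (near H' h) => //; exact: (near Sg' h).
apply: le_trans (ler_wpM2l (normr_ge0 _) He) _.
rewrite mulrCA -normrZ.
apply: (@le_trans _ _ (eps / (`|v| + 1) * (`|v| + 1))).
  by rewrite ler_wpM2l ?(ltW eps1)// (near B h).
by rewrite divfK// gt_eqF// ltr_wpDl.
Unshelve. all: by end_near. Qed.
End Along.

(** * Gradient, Hessian and convex functions *)

Section Gradient.
Context {R : realType} {d : nat}.
Implicit Types (U : set 'rV[R]_d) (f : 'rV[R]_d -> R).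

Lemma derive_grad f x v : differentiable f x -> 'D_v f x = dot v (grad f x).
Proof.
move=> df; rewrite deriveE // {1}(row_sum_delta v) linear_sum dotE.
by apply: eq_bigr => i _; rewrite linearZ mxE deriveE.
Qed.

Lemma differentiable_grad U f x : class_C 2 U f -> U x -> differentiable (grad f) x.
Proof.
move=> [_ H] Ux; apply: differentiable_rowE => i.
have -> : (fun y => grad f y 0 i) = 'D_(delta_mx 0 i) f.
  by apply/funext => y; rewrite mxE.
by have [H' _] := H (delta_mx 0 i); exact: H'.
Qed.

(** Row i of [hessian f x] is the derivative of the gradient in direction i, so v multiplies on the
    left and symmetry of second derivatives does not enter. *)
Lemma derive_hessian f x v : differentiable (grad f) x ->
  'D_v (grad f) x = v *m hessian f x.
Proof.
move=> df; rewrite deriveE // {1}(row_sum_delta v) linear_sum mulmx_sum_row.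
apply: eq_bigr => i _; rewrite linearZ; congr (_ *: _).
rewrite -deriveE // derive_mx; last exact: diff_derivable.
have E j : (fun y => grad f y 0 j) = (fun y => 'D_(delta_mx 0 j) f y).
  by apply/funext => y; rewrite mxE.
by apply/rowP => j; rewrite mxE E [RHS]mxE [RHS]mxE.
Qed.

(** By convexity, every difference quotient from x0 towards x with 0 < t <= 1 is at most f x - f
    x0. *)
Lemma convex_gradient_le U f x0 x : convex_function U f -> U x0 -> U x ->
  differentiable f x0 -> dot (x - x0) (grad f x0) <= f x - f x0.
Proof.
move=> cf U0 Ux df; rewrite -derive_grad//.
have /derive_at_right D := diff_derivable (v := x - x0) df.
rewrite -(cvg_lim (@Rhausdorff R) D); apply: limr_le; first exact: cvgP D.
near=> t; rewrite [leLHS](_ : _ = t^-1 * (f (t *: (x - x0) + x0) - f x0))//.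
have t0 : 0 < t by [].
have t1 : t <= 1 by near: t; exact: nbhs_right_le.
have -> : t *: (x - x0) + x0 = t *: x + (1 - t) *: x0.
  by rewrite scalerBr scalerBl scale1r -addrA [- _ + _]addrC.
rewrite ler_pdivrMl// lerBlDr.
apply: le_trans (convex_functionE cf Ux U0 _) _; first by rewrite (ltW t0).
by rewrite mulrBl mul1r mulrBr addrA addrAC.
Unshelve. all: by end_near. Qed.

Lemma compact_closed_ball r : compact [set x : 'rV[R]_d | `|x| <= r].
Proof.
apply: bounded_closed_compact.
  by exists r; split; first exact: num_real; move=> y ry x /= /le_trans; apply; exact: ltW.
have -> : [set x : 'rV[R]_d | `|x| <= r] = Num.norm @^-1` [set y | y <= r] by [].
apply: closed_comp; last exact: closed_le.
by move=> x _; exact: norm_continuous.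
Qed.

Lemma compact_sphere r : compact [set x : 'rV[R]_d | `|x| = r].
Proof.
apply: (subclosed_compact _ (@compact_closed_ball r)); last by move=> x /= ->.
have -> : [set x : 'rV[R]_d | `|x| = r] = Num.norm @^-1` [set y | y = r] by [].
apply: closed_comp; last exact: closed_eq.
by move=> x _; exact: norm_continuous.
Qed.

End Gradient.

(** * Openness of the gradient map of a convex function *)

Section GradientOpen.
Context {R : realType} {d : nat}.
Implicit Types (U : set 'rV[R]_d) (f : 'rV[R]_d -> R).

Lemma grad_local_min U f c p : open U -> U c -> differentiable f c ->
  (forall x, U x -> f c - dot c p <= f x - dot x p) -> grad f c = p.
Proof.
move=> oU Uc df fmin.
have dp := @differentiable_dotl R d p c.
have dh : differentiable (f - (fun x => dot x p)) c by exact: differentiableB.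
apply/rowP => i; rewrite mxE.
have := @derive_local_min _ _ _ c (delta_mx 0 i) dh.
rewrite deriveB; [|exact: diff_derivable|exact: diff_derivable].
rewrite derive_dotl (_ : dot _ p = p 0 i); last by rewrite /dot -rowE !mxE.
move=> H; apply/eqP; rewrite -subr_eq0 H//.
have : nbhs c U by exact: open_nbhs_nbhs.
by apply: filterS => x Ux; exact: fmin.
Qed.

(* If the convex function f - <., p0>, with p0 = grad f 0, had a second minimum
   c, it would be constant on [0, c], so grad f would be constant there and c
   would be in the kernel of the Hessian.  So its minimum at 0 is strict, and
   f - <., p> has a minimum near 0 for p close to p0.  This does not use the
   symmetry of the Hessian. *)
Lemma grad_open U f : open U -> U 0 -> class_C 2 U f -> convex_function U f ->
  \det (hessian f 0) != 0 ->
  \forall p \near grad f 0, exists2 x, U x & grad f x = p.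
Proof.
move=> oU U0 fC cf detH; pose p0 := grad f 0.
have df x : U x -> differentiable f x by case: fC => + _; apply.
have cvx x : U x -> f 0 <= f x - dot x p0.
  move=> Ux; have := convex_gradient_le cf U0 Ux (df _ U0).
  by rewrite subr0 lerBrDl -lerBrDr.
have [r r0 rU] : exists2 r, 0 < r & forall x : 'rV[R]_d, `|x| <= r -> U x.
  have /nbhs_ballP[e /= e0 eU] := open_nbhs_nbhs (conj oU U0).
  exists (e / 2); first exact: divr_gt0.
  move=> x xe; apply: eU; rewrite -ball_normE /= sub0r normrN.
  by rewrite (le_lt_trans xe)// ltr_pdivrMr// ltr_pMr// ltr1n.
have fcont p (A : set 'rV[R]_d) : A `<=` U -> {within A, continuous (fun x => f x - dot x p)}.
  move=> AU; apply: continuous_in_subspaceT => x /set_mem/AU Ux.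
  apply: differentiable_continuous; apply: differentiableB; first exact: df.
  exact: differentiable_dotl.
have [m m0 mP] : exists2 m, 0 < m & forall x, `|x| = r -> f 0 + m <= f x - dot x p0.
  (* The sphere is empty when d = 0, and any positive m then works. *)
  have [S0|/set0P/negP/negPn/eqP S0] :=
    pselect ([set x : 'rV[R]_d | `|x| = r] !=set0); last first.
    exists 1 => // x xr; have : [set x : 'rV[R]_d | `|x| = r] x by [].
    by rewrite S0.
  have SU : [set x : 'rV[R]_d | `|x| = r] `<=` U by move=> x /= xr; apply: rU; rewrite xr.
  have [c /set_mem /= cr cmin] := compact_EVT_min S0 (@compact_sphere R d r) (fcont p0 _ SU).
  have Uc : U c by apply: SU.
  exists (f c - dot c p0 - f 0); last first.
    by move=> x xr; rewrite addrCA subrr addr0 cmin// inE.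
  rewrite subr_gt0 lt_neqAle cvx// andbT; apply/negP => /eqP fc.
  have seg t : 0 <= t <= 1 -> grad f (t *: c) = p0.
    move=> t01.
    have Ut : U (t *: c).
      apply: rU; rewrite normrZ cr; case/andP: t01 => t0 t1.
      by rewrite ger0_norm// ler_piMl// ltW.
    apply: (grad_local_min oU Ut (df _ Ut)) => x Ux.
    apply: le_trans (cvx x Ux).
    have := convex_functionE cf Uc U0 t01.
    rewrite scaler0 addr0 dotZl => H; rewrite lerBlDr (le_trans H)//.
    rewrite -[f c](subrK (dot c p0)) -fc mulrDr addrAC -mulrDl.
    by rewrite [t + _]addrCA subrr addr0 mul1r.
  have : 'D_c (grad f) 0 = 0.
    apply: derive_at_right_eq0; first exact/diff_derivable/(differentiable_grad fC).
    near=> t; rewrite addr0 seg//; apply/andP; split.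
      by apply: ltW.
    by near: t; exact: nbhs_right_le.
  rewrite derive_hessian; last exact: (differentiable_grad fC).
  move=> /(congr1 (mulmxr (invmx (hessian f 0)))) /=.
  rewrite mul0mx mulmxK ?unitmxE ?unitfE// => c0.
  by move: cr r0; rewrite c0 normr0 => <-; rewrite ltxx.
near=> p.
have BU : [set x : 'rV[R]_d | `|x| <= r] `<=` U by move=> x /= /rU.
have B0 : [set x : 'rV[R]_d | `|x| <= r] !=set0 by exists 0 => /=; rewrite normr0 ltW.
have [c /set_mem /= cr cmin] := compact_EVT_min B0 (@compact_closed_ball R d r) (fcont p _ BU).
(* On the sphere the value is at least f 0 + m - |<c, p - p0>|, and |<c, p - p0>| <= d r |p - p0| <
   m, so it exceeds the value f 0 taken at 0. The [+ 1] in the bound on p - p0 keeps the divisor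
   positive when d = 0. *)
have cr' : `|c| < r.
  rewrite lt_neqAle cr andbT; apply/negP => /eqP {}cr.
  have := cmin 0; rewrite inE /= normr0 => /(_ (ltW r0)).
  rewrite {2}/dot mul0mx mxE subr0 leNgt => /negP; apply.
  have -> : f c - dot c p = f c - dot c p0 - dot c (p - p0).
    by rewrite dotBr opprB addrA subrK.
  rewrite ltrBrDr; apply: lt_le_trans (mP c cr); rewrite ltrD2l.
  apply: le_lt_trans (ler_norm _) _.
  apply: le_lt_trans (dot_bound _ _) _; rewrite cr.
  have : `|p - p0| < m / (d%:R * r + 1).
    rewrite distrC; near: p; apply: (@cvgr_dist_lt _ _ _ _ _ id) => //.
    by rewrite divr_gt0// ltr_wpDl// mulr_ge0// ltW.
  rewrite ltr_pdivlMr; last by rewrite ltr_wpDl// mulr_ge0// ltW.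
  apply: le_lt_trans.
  by rewrite mulrA mulrC ler_wpM2l// lerDl.
exists c; first exact: BU.
have oB : open (ball (0 : 'rV[R]_d) r) by exact: ball_open.
apply: (grad_local_min oB) => //.
- by rewrite -ball_normE /= sub0r normrN.
- exact/df/BU.
- by move=> x; rewrite -ball_normE /= sub0r normrN => /ltW xr; apply: cmin; rewrite inE.
Unshelve. all: by end_near. Qed.

End GradientOpen.

(** * Coordinates of vectors and linear forms in a frame *)

Section Coordinates.
Context {R : realType} {d : nat}.
Local Notation V := 'rV[R]_(d + 1).
Implicit Types (A : 'M[R]_(d + 1)) (v : V) (phi : 'cV[R]_(d + 1)).

(** Horizontal part, that is the first d coordinates in the basis of the rows of A; [vcoord] is the
    last coordinate. This is the splitting used by [graph_at] and by the cone coordinates. *)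
Definition hcoord A v : 'rV[R]_d := v *m lsubmx (invmx A).
Definition vcoord A v : R := (v *m rsubmx (invmx A)) 0 0.

Lemma coordK A v : A \in unitmx ->
  row_mx (hcoord A v) (vcoord A v)%:M *m A = v.
Proof.
move=> uA; rewrite /hcoord /vcoord -mx11_scalar mulmx_lsub mulmx_rsub hsubmxK.
by rewrite mulmxKV.
Qed.

Lemma hcoordK A x (s : R) : A \in unitmx ->
  hcoord A (row_mx x s%:M *m A) = x.
Proof. by move=> uA; rewrite /hcoord mulmx_lsub mulmxK// row_mxKl. Qed.

Lemma vcoordK A (x : 'rV[R]_d) (s : R) : A \in unitmx ->
  vcoord A (row_mx x s%:M *m A) = s.
Proof.
by move=> uA; rewrite /vcoord mulmx_rsub mulmxK// row_mxKr mxE mulr1n.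
Qed.

(** Thus the kernel of [covector A y] is the graph of the linear form <., y>. This compares tangent
    hyperplanes of graphs with points of the dual domain. *)
Lemma pairing_covector A v y :
  pairing v (covector A y) = dot (hcoord A v) y - vcoord A v.
Proof.
rewrite /pairing /covector mulmxA tr_row_mx -[X in X *m _]hsubmxK mul_row_col.
rewrite /hcoord /vcoord /dot mulmx_lsub mulmx_rsub mxE; congr (_ + _).
by rewrite tr_scalar_mx mul_mx_scalar mxE mulN1r.
Qed.

Lemma pairingZr v a phi : pairing v (a *: phi) = a * pairing v phi.
Proof. by rewrite /pairing -scalemxAr mxE. Qed.

Lemma pairingZl v a phi : pairing (a *: v) phi = a * pairing v phi.
Proof. by rewrite /pairing -scalemxAl mxE. Qed.

Lemma pairingDl v w phi : pairing (v + w) phi = pairing v phi + pairing w phi.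
Proof. by rewrite /pairing mulmxDl mxE. Qed.

Lemma pairingDr v phi psi : pairing v (phi + psi) = pairing v phi + pairing v psi.
Proof. by rewrite /pairing mulmxDr mxE. Qed.

Lemma pairingNl v phi : pairing (- v) phi = - pairing v phi.
Proof. by rewrite /pairing mulNmx mxE. Qed.

Lemma pairingNr v phi : pairing v (- phi) = - pairing v phi.
Proof. by rewrite /pairing mulmxN mxE. Qed.

Lemma mulmx_covector A y : A \in unitmx ->
  A *m covector A y = col_mx y^T (- 1)%:M.
Proof.
by move=> uA; rewrite /covector mulKVmx// tr_row_mx tr_scalar_mx.
Qed.

Lemma covector_neq0 A y : A \in unitmx -> covector A y != 0.
Proof.
move=> uA; apply/eqP => /(congr1 (mulmx A)); rewrite mulmx_covector// mulmx0.
move=> /(congr1 dsubmx); rewrite col_mxKd => /matrixP/(_ 0 0).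
by rewrite !mxE mulr1n => /eqP; rewrite oppr_eq0 oner_eq0.
Qed.

(* The y such that phi is proportional to covector A y; meaningless when the
   last coordinate of phi vanishes. *)
Definition affine_coord A phi : 'rV[R]_d :=
  (- dsubmx (A *m phi) 0 0)^-1 *: (usubmx (A *m phi))^T.

Lemma covector_affine_coord A phi : A \in unitmx -> dsubmx (A *m phi) 0 0 != 0 ->
  phi = (- dsubmx (A *m phi) 0 0) *: covector A (affine_coord A phi).
Proof.
move=> uA c0; apply: (can_inj (mulKmx uA)).
rewrite -scalemxAr mulmx_covector// scale_col_mx /affine_coord.
rewrite linearZ /= trmxK scalerA mulfV ?oppr_eq0// scale1r.
rewrite -[LHS]vsubmxK; congr col_mx; apply/matrixP => i j; rewrite !ord1.
by rewrite [RHS]mxE [X in _ * X]mxE mulr1n mulrN1 opprK.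
Qed.

Lemma affine_coordZ A y s : A \in unitmx -> s != 0 ->
  affine_coord A (s *: covector A y) = y.
Proof.
move=> uA s0; rewrite /affine_coord -scalemxAr mulmx_covector// scale_col_mx.
rewrite col_mxKu col_mxKd linearZ /= trmxK !mxE mulr1n mulrN1 opprK scalerA.
by rewrite mulVf// scale1r.
Qed.

(** Evaluating phi on the vectors (w, <w, y>) of the kernel forces its coordinates in the basis A to
    be proportional to (y, -1). *)
Lemma covector_ker A phi y : A \in unitmx -> phi != 0 ->
  [set v | pairing v phi = 0] = [set v | pairing v (covector A y) = 0] ->
  exists2 s, s != 0 & phi = s *: covector A y.
Proof.
move=> uA phi0 kerE.
pose c := dsubmx (A *m phi) 0 0.
have uE : usubmx (A *m phi) = - c *: y^T.
  have H (w : 'rV[R]_d) : w *m usubmx (A *m phi) = - c *: (w *m y^T).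
    pose v := row_mx w (dot w y)%:M *m A.
    have : [set v | pairing v phi = 0] v.
      by rewrite kerE /= pairing_covector hcoordK// vcoordK// subrr.
    rewrite /= /pairing /v -mulmxA -[A *m phi]vsubmxK mul_row_col mxE.
    rewrite mul_scalar_mx [X in _ + X]mxE -/c => /eqP; rewrite addr_eq0 => /eqP E.
    by apply/matrixP => i j; rewrite !ord1 col_mxKu E mxE mulNr mulrC.
  by apply/row_matrixP => i; rewrite !rowE H -scalemxAr.
have phiE : phi = - c *: covector A y.
  apply: (can_inj (mulKmx uA)); rewrite -scalemxAr mulmx_covector// scale_col_mx.
  rewrite -[LHS]vsubmxK uE; congr col_mx; apply/matrixP => i j; rewrite !ord1.
  by rewrite [RHS]mxE [X in _ * X]mxE mulr1n mulrN1 opprK.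
exists (- c) => //; apply: contraNneq phi0 => c0.
by rewrite phiE c0 scale0r.
Qed.

Lemma differentiable_pairing v phi : differentiable (pairing v) phi.
Proof.
rewrite (_ : pairing v = fun p => \sum_i v 0 i * p i 0).
  apply: differentiable_fun_sum => i; apply: differentiableM.
    exact: differentiable_cst.
  exact: differentiable_coord.
by apply/funext => p; rewrite /pairing mxE.
Qed.

Lemma continuous_pairing v : continuous (pairing v).
Proof. by move=> phi; apply: differentiable_continuous; exact: differentiable_pairing. Qed.

Lemma dsubmx_pairing A phi :
  dsubmx (A *m phi) 0 0 = pairing (row (rshift d 0) A) phi.
Proof. by rewrite /pairing -row_mul !mxE. Qed.

Lemma usubmx_pairing A phi i :
  usubmx (A *m phi) i 0 = pairing (row (lshift 1 i) A) phi.
Proof. by rewrite /pairing -row_mul !mxE. Qed.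

Lemma differentiable_affine_coord A phi : dsubmx (A *m phi) 0 0 != 0 ->
  differentiable (affine_coord A) phi.
Proof.
rewrite dsubmx_pairing => c0; apply: differentiable_rowE => i.
rewrite (_ : (fun y => _) = fun p => (- pairing (row (rshift d 0) A) p)^-1 *
    pairing (row (lshift 1 i) A) p); last first.
  apply/funext => p.
  by rewrite /affine_coord dsubmx_pairing mxE mxE usubmx_pairing.
apply: differentiableM; last exact: differentiable_pairing.
apply: differentiableV; last by rewrite oppr_eq0.
apply: differentiableN; exact: differentiable_pairing.
Qed.

End Coordinates.

(** * Graph charts and their tangent hyperplanes *)

Section Charts.
Context {R : realType} {d : nat}.
Local Notation V := 'rV[R]_(d + 1).
Implicit Types (S W : set V) (P : V) (A : 'M[R]_(d + 1)).

Lemma is_derive_hcoord A (g : R -> V) t v P : is_derive (t : R) 1 g v ->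
  is_derive (t : R) 1 (fun s => hcoord A (g s - P)) (hcoord A v).
Proof.
move=> dg; apply: is_derive_mulmxr; rewrite -[v]subr0.
exact: (@is_deriveB _ _ _ g (cst P)).
Qed.

Lemma is_derive_vcoord A (g : R -> V) t v P : is_derive (t : R) 1 g v ->
  is_derive (t : R) 1 (fun s => vcoord A (g s - P)) (vcoord A v).
Proof.
move=> dg; apply: (@is_derive_coord _ _ (fun s => (g s - P) *m rsubmx (invmx A))).
apply: is_derive_mulmxr; rewrite -[v]subr0.
exact: (@is_deriveB _ _ _ g (cst P)).
Qed.

(** Here P is only the origin of the coordinates: it need not lie in S or W. One chart thus serves
    at all the points of S near P, with the neighbourhood W made explicit. *)
Definition graph_chart S W P A (U : set 'rV[R]_d) (f : 'rV[R]_d -> R) :=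
  [/\ A \in unitmx, open U, open W &
     S `&` W = [set P + row_mx x (f x)%:M *m A | x in U]].

Lemma graph_curve S W P A U f (g : R -> V) v :
  graph_chart S W P A U f -> W (g 0) -> (\forall t \near (0 : R), S (g t)) ->
  is_derive (0 : R) 1 g v ->
  \forall t \near (0 : R), U (hcoord A (g t - P)) /\
    g t = P + row_mx (hcoord A (g t - P)) (f (hcoord A (g t - P)))%:M *m A.
Proof.
move=> [uA oU oW SW] W0 Sg dg.
have Wg := near_curve dg (open_nbhs_nbhs (conj oW W0)).
near=> t.
have [x Ux xg] : [set P + row_mx x (f x)%:M *m A | x in U] (g t).
  by rewrite -SW; split; [exact: (near Sg t) | exact: (near Wg t)].
by rewrite -xg addrAC subrr add0r hcoordK.
Unshelve. all: by end_near. Qed.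

Lemma graph_mem S W P A U f x : graph_chart S W P A U f -> U x ->
  (S `&` W) (P + row_mx x (f x)%:M *m A).
Proof. by move=> [_ _ _ ->] Ux; exists x. Qed.

Lemma is_derive_row_mx (a : R -> 'rV[R]_d) (b : R -> R) (t : R) v s :
  is_derive t 1 a v -> is_derive t 1 b s ->
  is_derive t 1 (fun u => row_mx (a u) (b u)%:M) (row_mx v s%:M).
Proof.
move=> da db; apply: is_derive_row => i.
rewrite -(splitK i); case: (fintype.split i) => j /=.
  rewrite row_mxEl (_ : (fun u => _) = fun u => a u 0 j).
    exact: is_derive_coord.
  by apply/funext => u; rewrite row_mxEl.
rewrite row_mxEr mxE !ord1 mulr1n (_ : (fun u => _) = b) //.
by apply/funext => u; rewrite row_mxEr mxE mulr1n.
Qed.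

(** Along a curve in the graph the vertical coordinate is f of the horizontal one, and the chain
    rule gives one inclusion. Conversely, the line through x with velocity [hcoord A v] is lifted to
    the graph. *)
Lemma tangent_graph S W P A U f x : graph_chart S W P A U f -> U x ->
  differentiable f x ->
  tangent S (P + row_mx x (f x)%:M *m A) =
  [set v | pairing v (covector A (grad f x)) = 0].
Proof.
move=> gr Ux df; have [uA oU oW SW] := gr.
apply/seteqP; split => v.
  move=> [g [g0 Sg dg]].
  have Wg : W (g 0) by rewrite g0; have [] := graph_mem gr Ux.
  have H := graph_curve gr Wg Sg dg.
  have dh := is_derive_hcoord A P dg; have dv := is_derive_vcoord A P dg.
  have h0 : hcoord A (g 0 - P) = x by rewrite g0 addrAC subrr add0r hcoordK.
  have df0 : differentiable f (hcoord A (g 0 - P)) by rewrite h0.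
  have := is_derive_comp_diff df0 dh; rewrite derive_grad// h0 => dfh.
  have E : \forall t \near (0 : R),
      (f \o (fun s => hcoord A (g s - P))) t = vcoord A (g t - P).
    move: H; apply: filterS => t [_ gt] /=.
    by rewrite [in RHS]gt addrAC subrr add0r vcoordK.
  have := near_eq_is_derive E dfh => -[_ d1]; have [_ d2] := dv.
  by rewrite /= pairing_covector -d1 -d2 subrr.
rewrite /= pairing_covector => /eqP; rewrite subr_eq0 => /eqP vE.
have dl : is_derive (0 : R) 1 (fun t : R => x + t *: hcoord A v) (hcoord A v).
  apply/is_derive1_cvg; apply: cvg_near_cst; near=> t.
  rewrite scale0r addr0 addrAC subrr add0r scalerA mulVf ?scale1r//.
  near: t; exact: nbhs_dnbhs_neq.
pose q (t : R) := x + t *: hcoord A v.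
exists (fun t : R => P + row_mx (q t) (f (q t))%:M *m A); split.
- by rewrite /q scale0r addr0.
- have : nbhs (q 0) U by rewrite /q scale0r addr0; exact: open_nbhs_nbhs.
  move=> /(near_curve dl); apply: filterS => t Uq.
  by have [] := graph_mem gr Uq.
- have dfq : differentiable f (q 0) by rewrite /q scale0r addr0.
  have := is_derive_comp_diff dfq dl; rewrite derive_grad// /q scale0r addr0 vE => dfq'.
  have := is_derive_mulmxr A (is_derive_row_mx dl dfq').
  rewrite coordK// => D.
  by have := is_deriveD (is_derive_cst P (0 : R) 1) D; rewrite add0r.
Unshelve. all: by end_near. Qed.

End Charts.

(** * Tangent hyperplanes of convex domains support them *)

Section Convex.
Context {R : realType} {d : nat}.
Local Notation V := 'rV[R]_(d + 1).
Implicit Types (K C : set V) (P : V).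

Lemma boundary_openP K P : open K -> boundary K P -> closure K P /\ ~ K P.
Proof. by move=> oK [cK nK]; split=> // KP; apply: nK; exact: open_nbhs_nbhs. Qed.

(** P is replaced by a nearby Q of K, and z by the point F Q that leaves the combination unchanged.
    Since F P = z and K is open, F Q is in K for Q close to P. *)
Lemma convex_open_closure K P z (h : R) : open K -> convex_set K ->
  closure K P -> K z -> 0 < h <= 1 -> K (h *: z + (1 - h) *: P).
Proof.
move=> oK cK clP Kz /andP[h0 h1].
pose F (Q : V) : V := z - ((1 - h) / h) *: (Q - P).
have FP : F P = z by rewrite /F subrr scaler0 subr0.
have cF : {for P, continuous F}.
  apply: differentiable_continuous; apply: differentiableB.
    exact: differentiable_cst.
  by apply: differentiableZ; apply: differentiableB.
have : nbhs (F P) K by rewrite FP; exact: open_nbhs_nbhs.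
move=> /cF /clP [Q [KQ KFQ]].
have -> : h *: z + (1 - h) *: P = h *: F Q + (1 - h) *: Q.
  rewrite /F scalerBr scalerA mulrCA mulfV ?gt_eqF// mulr1 scalerBr.
  by rewrite opprB -[RHS]addrA subrK.
by apply: convex_setE => //; rewrite (ltW h0).
Qed.

(* A curve in boundary K leaving P with velocity Q - P would enter the convex
   hull of P and a neighbourhood of Q. *)
Lemma tangent_disjoint K P Q : open K -> convex_set K -> boundary K P -> K Q ->
  ~ tangent (boundary K) P (Q - P).
Proof.
move=> oK cK bP KQ [g [g0 Sg dg]].
have [clP _] := boundary_openP oK bP.
have /is_derive1_cvg/cvg_dnbhs_at_right gv := dg.
have HK : \forall h \near (0 : R)^'+, K (P + h^-1 *: (g h - P)).
  have : (fun h : R => P + h^-1 *: (g h - P)) @ 0^'+ --> Q.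
    rewrite -[Q](subrK P) [_ + P]addrC; apply: cvgD; first exact: cvg_cst.
    by rewrite -{1}g0.
  by apply; exact: open_nbhs_nbhs.
have Sg' : \forall h \near (0 : R)^'+, boundary K (g h).
  by apply: cvg_at_right_filter Sg; exact: cvg_id.
have [h [h0 h1 Kh Sh]] : exists h : R,
    [/\ 0 < h, h <= 1, K (P + h^-1 *: (g h - P)) & boundary K (g h)].
  near (0 : R)^'+ => h; exists h; split => //; first by near: h; exact: nbhs_right_le.
    exact: (near HK h).
  exact: (near Sg' h).
have [_] := boundary_openP oK Sh; apply.
(* The combination of [P + h^-1 *: (g h - P)] and P with weights h and 1 - h is g h, which would
   then be in the open set K and not on its boundary. *)
have := convex_open_closure oK cK clP Kh (h := h).
rewrite h0 h1 => /(_ isT); rewrite scalerDr scalerA mulfV ?gt_eqF// scale1r.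
by rewrite scalerBl scale1r addrAC [h *: P + _]addrC subrK addrC subrK.
Unshelve. all: by end_near. Qed.

Lemma tangent_supporting K P phi : open K -> convex_set K -> boundary K P ->
  phi != 0 -> tangent (boundary K) P = [set v | pairing v phi = 0] ->
  supporting_direction K phi.
Proof.
move=> oK cK bP phi0 TE; split => //; exists (pairing P phi); split; last by exists P.
move=> x Kx; apply/eqP => E; apply: (tangent_disjoint oK cK bP Kx).
by rewrite TE /= pairingDl pairingNl E subrr.
Qed.

End Convex.

(** * The dual cone, its projective closure and its coordinates *)

Section DualCone.
Context {R : realType} {d : nat}.
Local Notation V := 'rV[R]_(d + 1).
Implicit Types (K C : set V) (P : V) (phi : 'cV[R]_(d + 1)).

(** A form taking both strict signs on C keeps them under small perturbation, whereas a nonzero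
    multiple of a form in the dual cone has a constant weak sign on C. *)
Lemma closure_proj_dual_cone_sign C phi : closure (proj_dual_cone C) phi ->
  (forall v, C v -> pairing v phi <= 0) \/ (forall v, C v -> 0 <= pairing v phi).
Proof.
move=> clphi.
have [|/existsNP[v1 /not_implyP[Cv1 /negP]]] :=
  pselect (forall v, C v -> pairing v phi <= 0); first by left.
rewrite -ltNge => v1phi.
have [|/existsNP[v2 /not_implyP[Cv2 /negP]]] :=
  pselect (forall v, C v -> 0 <= pairing v phi); first by right.
rewrite -ltNge => v2phi.
have n1 : \forall psi \near phi, 0 < pairing v1 psi.
  exact: (cvgr_gt _ (@continuous_pairing R d v1 phi)).
have n2 : \forall psi \near phi, pairing v2 psi < 0.
  exact: (cvgr_lt _ (@continuous_pairing R d v2 phi)).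
have [psi [[t [t0 /interior_subset dt]] [psi1 psi2]]] := clphi _ (filterI n1 n2).
have := dt _ Cv1; have := dt _ Cv2; rewrite /= !pairingZr.
rewrite (nmulr_lle0 _ psi2) (pmulr_lle0 _ psi1) => ta tb.
by move: t0; rewrite eq_le ta tb.
Qed.

Lemma pairing_neq0 C phi : open C -> C !=set0 -> phi != 0 ->
  exists2 v, C v & pairing v phi != 0.
Proof.
move=> oC [v Cv] phi0.
have [v0|] := eqVneq (pairing v phi) 0; last by exists v.
have [i phii] : exists i, phi i 0 != 0.
  apply/existsP; apply: contraNT phi0; rewrite negb_exists => /forallP H.
  apply/eqP/matrixP => i j; rewrite ord1 mxE; apply/eqP/negPn; exact: H.
pose e : V := delta_mx 0 i.
have pe : pairing e phi = phi i 0 by rewrite /pairing -rowE mxE.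
have ce : {for (0 : R), continuous (fun t : R => v + t *: e)}.
  apply: differentiable_continuous; apply: differentiableD.
    exact: differentiable_cst.
  by apply: differentiableZl.
have : nbhs (v + 0 *: e) C by rewrite scale0r addr0; exact: open_nbhs_nbhs.
move=> /ce /nbhs_dnbhs H.
near (0 : R)^' => t; exists (v + t *: e); first exact: (near H t).
rewrite pairingDl pairingZl v0 add0r pe mulf_neq0//.
by near: t; exact: nbhs_dnbhs_neq.
Unshelve. all: by end_near. Qed.

(** All forms near phi have a constant weak sign on C. The scalar s makes phi negative at one v of
    C; nearby forms are still negative there, which selects the nonpositive alternative for all of
    them at once. *)
Lemma proj_dual_cone_interior C phi : open C -> C !=set0 -> phi != 0 ->
  (\forall psi \near phi, closure (proj_dual_cone C) psi) ->
  exists2 s, s != 0 & dual_cone C (s *: phi).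
Proof.
move=> oC C0 phi0 H; have [v Cv vphi] := pairing_neq0 oC C0 phi0.
have [s s0 sphi] : exists2 s, s != 0 & pairing v (s *: phi) < 0.
  move: vphi; rewrite neq_lt => /orP[|] vphi; [exists 1|exists (-1)] => //.
  - by rewrite scale1r.
  - by rewrite pairingZr mulN1r oppr_lt0.
exists s => //.
have n1 : \forall psi \near s *: phi, pairing v psi < 0.
  exact: (cvgr_lt _ (@continuous_pairing R d v (s *: phi))).
have cs : {for s *: phi, continuous (fun psi : 'cV[R]_(d + 1) => s^-1 *: psi)}.
  by apply: differentiable_continuous; apply: differentiableZ.
have n2 : \forall psi \near s *: phi, closure (proj_dual_cone C) (s^-1 *: psi).
  by apply: cs; rewrite scalerA mulVf// scale1r.
apply: filterS (filterI n1 n2) => psi [psi1] /closure_proj_dual_cone_sign.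
have S w : pairing w psi = s * pairing w (s^-1 *: psi).
  by rewrite pairingZr mulrA mulfV// mul1r.
case=> Hpsi w Cw; have := Hpsi _ Cw; have := Hpsi _ Cv; move: psi1; rewrite !S.
  move=> p1 p2 p3; rewrite mulr_ge0_le0//.
  have [//|sN] := leP 0 s; by move: p1; rewrite ltNge mulr_le0// ltW.
move=> p1 p2 p3; rewrite mulr_le0_ge0//.
have [//|sN] := leP s 0; by move: p1; rewrite ltNge mulr_ge0// ltW.
Unshelve. all: by end_near. Qed.

(** As phi is interior, some [e *: covector A 0] can be subtracted from it with the result still
    nonpositive on C. On the vectors (x, 1) this leaves a margin e, which survives the passage to
    the closure of Omega and yields the strict inequality of [dual_domain]. The case x = 0 gives c <
    0. *)
Lemma dual_cone_covector C A Omega phi : cone_coordinates C A Omega ->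
  dual_cone C phi ->
  exists s y, [/\ 0 < s, dual_domain Omega y & phi = s *: covector A y].
Proof.
move=> [detA [oO cO bO O0] CE] dphi.
have uA : A \in unitmx by rewrite unitmxE detA unitr1.
have cc : {for (0 : R), continuous (fun e : R => phi - e *: covector A 0)}.
  apply: differentiable_continuous; apply: differentiableB.
    exact: differentiable_cst.
  by apply: differentiableZl.
have : nbhs (phi - (0 : R) *: covector A 0) [set phi | forall v, C v -> pairing v phi <= 0].
  by rewrite scale0r subr0.
move=> /cc H.
have [e e0 He] : exists2 e : R, 0 < e &
    forall v, C v -> pairing v (phi - e *: covector A 0) <= 0.
  have H' : \forall e \near (0 : R)^'+,
      forall v, C v -> pairing v (phi - e *: covector A 0) <= 0.
    by apply: cvg_at_right_filter H; exact: cvg_id.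
  near (0 : R)^'+ => e; exists e => //; exact: (near H' e).
pose u := (usubmx (A *m phi))^T; pose c := dsubmx (A *m phi) 0 0.
have Hx x : Omega x -> dot x u + c + e <= 0.
  move=> Ox; have := He (row_mx x 1%:M *m A).
  rewrite CE => /(_ _)/wrap[]; first by exists x, 1; rewrite scale1r.
  rewrite pairingDr pairingNr pairingZr pairing_covector hcoordK// vcoordK//.
  rewrite (_ : dot x 0 = 0); last by rewrite /dot trmx0 mulmx0 mxE.
  rewrite sub0r mulrN1 opprK.
  rewrite {1}/pairing -mulmxA -[A *m phi]vsubmxK mul_row_col mxE mul1mx.
  by rewrite /dot /u trmxK /c.
have c0 : c < 0.
  have := Hx _ O0; rewrite /dot mul0mx mxE add0r => H0.
  by rewrite (lt_le_trans _ H0)// ltrDl.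
exists (- c), (affine_coord A phi); split; first by rewrite oppr_gt0.
  move=> x clx.
  have : dot x u + c + e <= 0.
    have cl : closed [set x | dot x u <= - c - e].
      apply: (@closed_comp _ _ (fun x => dot x u) [set y | y <= - c - e]);
        last exact: closed_le.
      move=> z _; apply: differentiable_continuous; exact: differentiable_dotl.
    have : [set x | dot x u <= - c - e] x.
      by apply: cl; apply: closure_subset clx => z /Hx /=;
        rewrite -addrA -opprD lerNr addrC -subr_le0 opprK.
    by rewrite /= -opprD -subr_le0 opprK addrA.
  move=> Hle; rewrite dotC /affine_coord dotZl dotC -/u -/c.
  rewrite ltr_pdivrMl ?oppr_gt0// mulr1 -subr_lt0 opprK.
  by apply: lt_le_trans Hle; rewrite ltrDl.
by apply: covector_affine_coord => //; rewrite lt_eqF.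
Unshelve. all: by end_near. Qed.

End DualCone.

(** * Crossing the boundary, and contact with the tangent hyperplane *)

Section Segment.
Context {R : realType} {d : nat}.
Local Notation V := 'rV[R]_(d + 1).
Implicit Types (K C S W : set V) (P : V) (A : 'M[R]_(d + 1)).

(** Take the supremum of the parameters in [0, 1] whose point is in K. That point is adherent to K;
    if it were in K, the parameter would be less than 1 and openness would allow a larger one. *)
Lemma boundary_segment K (a b : V) : open K -> K a -> ~ K (a + b) ->
  exists s : R, 0 <= s <= 1 /\ boundary K (a + s *: b).
Proof.
move=> oK Ka Kb.
pose E := [set s : R | 0 <= s <= 1 /\ K (a + s *: b)].
have E0 : E 0 by split; rewrite ?lexx ?ler01// scale0r addr0.
have supE : has_sup E.
  by split; [exists 0 | exists 1 => s [/andP[]]].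
have s01 : 0 <= sup E <= 1.
  rewrite sup_upper_bound//=; apply: ge_sup; first by exists 0.
  by move=> s [/andP[]].
have cg (s : R) : {for s, continuous (fun t : R => a + t *: b)}.
  apply: differentiable_continuous; apply: differentiableD.
    exact: differentiable_cst.
  by apply: differentiableZl.
exists (sup E); split => //; split.
  move=> B /cg /nbhs_ballP[e /= e0 eB].
  have [s Es se] := sup_adherent e0 supE.
  exists (a + s *: b); split; first by case: Es.
  apply: eB; rewrite -ball_normE /= ger0_norm; first by rewrite ltrBlDl -ltrBlDr.
  by rewrite subr_ge0 sup_upper_bound.
move=> /interior_subset Ks.
have s1 : sup E < 1.
  have [_] := andP s01; rewrite le_eqVlt => /predU1P[s1|//].
  by case: Kb; move: Ks; rewrite s1 scale1r.
have : nbhs (a + sup E *: b) K by exact: open_nbhs_nbhs.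
move=> /cg H.
have H' : \forall t \near (sup E)^'+, K (a + t *: b).
  by apply: cvg_at_right_filter H; exact: cvg_id.
near (sup E)^'+ => t.
have st : sup E < t by [].
have : t <= sup E.
  apply: sup_upper_bound => //; split; last exact: (near H' t).
  have [s0 _] := andP s01; rewrite (le_trans s0 (ltW st))/=.
  by near: t; exact: nbhs_right_le.
by rewrite leNgt st.
Unshelve. all: by end_near. Qed.

(** With x the horizontal part of Q - P, the pairing is the differential of f at 0 applied to x,
    minus f x, hence o(|x|). The Lipschitz constant k of [hcoord] converts this into o(|Q - P|). *)
Lemma graph_tangent_o S W P A U f e : graph_chart S W P A U f -> W P -> U 0 ->
  f 0 = 0 -> differentiable f 0 -> 0 < e ->
  \forall Q \near P, S Q ->
    `|pairing (Q - P) (covector A (grad f 0))| <= e * `|Q - P|.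
Proof.
move=> gr WP U0 f0 df e0; have [uA oU oW SW] := gr.
have [k k0 kP] := linear_lipschitz (@mulmxr_continuous _ _ _ (lsubmx (invmx A))).
have ek : 0 < e / k by rewrite divr_gt0.
have cQ : {for P, continuous (fun Q : V => hcoord A (Q - P))}.
  apply: differentiable_continuous.
  apply: (@differentiable_comp _ _ _ _ (fun Q : V => Q - P) (hcoord A)).
    exact: differentiableB.
  by case: (is_diff_mulmxr (lsubmx (invmx A)) (P - P)).
have h0 : hcoord A (P - P) = 0 by rewrite subrr /hcoord mul0mx.
have /eqaddoP/(_ _ ek) := diff_locally df; rewrite -{1}h0 => /cQ dfo.
have {}dfo : \forall Q \near P,
    `|(f \o shift 0 - (cst (f 0) + 'd f 0)) (hcoord A (Q - P))| <= e / k * `|hcoord A (Q - P)|.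
  exact: dfo.
have nW : \forall Q \near P, W Q by exact: open_nbhs_nbhs.
near=> Q => SQ.
have [x Ux xQ] : [set P + row_mx x (f x)%:M *m A | x in U] Q.
  by rewrite -SW; split => //; exact: (near nW Q).
have hQ : hcoord A (Q - P) = x by rewrite -xQ addrAC subrr add0r hcoordK.
have vQ : vcoord A (Q - P) = f x by rewrite -xQ addrAC subrr add0r vcoordK.
have := near dfo Q; move=> /(_ _)/wrap[//|].
rewrite hQ [X in `|X| <= _](_ : _ = f x - 'd f 0 x); last first.
  by rewrite !fctE /= addr0 f0 add0r.
move=> dfx; rewrite pairing_covector vQ hQ -derive_grad// deriveE// distrC.
apply: le_trans dfx _.
rewrite -hQ mulrAC ler_pdivrMr// -mulrA ler_wpM2l ?(ltW e0)//.
by rewrite mulrC; exact: kP.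
Unshelve. all: by end_near. Qed.

End Segment.

(** * The Gauss map: values, differentiability, and the inward side *)

Section GaussMap.
Context {R : realType} {d : nat}.
Local Notation V := 'rV[R]_(d + 1).
Implicit Types (K C S W : set V) (P : V) (A : 'M[R]_(d + 1)).

Lemma graph_at_chart S P A U f : S P -> graph_at S P A U f ->
  exists W, [/\ graph_chart S W P A U f, W P, U 0 & f 0 = 0].
Proof.
move=> SP [uA oU U0 [W [oW WP SW]]]; exists W; split => //.
have [x Ux] : [set P + row_mx x (f x)%:M *m A | x in U] P by rewrite -SW.
move=> /(congr1 (fun Q => Q - P)); rewrite addrAC subrr add0r => E.
have := congr1 (hcoord A) E; have := congr1 (vcoord A) E.
rewrite hcoordK// vcoordK// /hcoord /vcoord !mul0mx mxE => fx x0.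
by rewrite -x0.
Qed.

(** The kernel of phi is the tangent hyperplane at the point of the chart above x. It supports K, so
    C-convexity applies to its direction. *)
Lemma supporting_covector C K P A U f W phi : C_convex_domain C K ->
  graph_chart (boundary K) W P A U f -> class_C 2 U f ->
  dsubmx (A *m phi) 0 0 != 0 -> 
  (exists2 x, U x & grad f x = affine_coord A phi) ->
  closure (proj_dual_cone C) phi.
Proof.
move=> [[_ oK cK] _ _ supp] gr fC c0 [x Ux gx]; have [uA _ _ _] := gr.
have [bQ _] := graph_mem gr Ux.
have df : differentiable f x by case: fC => + _; apply.
apply: supp; apply: (tangent_supporting oK cK bQ).
  by apply: contraNneq c0 => ->; rewrite mulmx0 linear0 mxE.
rewrite (tangent_graph gr Ux df) gx [in RHS](covector_affine_coord uA c0).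
apply/seteqP; split => v /=; rewrite pairingZr.
  by move=> ->; rewrite mulr0.
by move=> /eqP; rewrite mulf_eq0 oppr_eq0 (negPf c0) => /eqP.
Qed.

(** By [grad_open], every form close to phi directs a tangent hyperplane at a point of the chart, so
    a whole neighbourhood of phi is in the closure of the projective dual cone. Then
    [proj_dual_cone_interior] puts a multiple of phi in the dual cone itself. *)
Lemma tangent_direction C K A0 Omega P : open C -> C !=set0 ->
  C_convex_domain C K -> cone_coordinates C A0 Omega ->
  locally_uniformly_convex (boundary K) -> boundary K P ->
  exists y, dual_domain Omega y /\
    tangent (boundary K) P = [set v | pairing v (covector A0 y) = 0].
Proof.
move=> oC C0 CK cc luc bP.
have [A [U [f [gr' fC cU cf det0]]]] := luc _ bP.
have [W [gr WP U0 f0]] := graph_at_chart bP gr'.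
have [uA oU _ _] := gr.
have df : differentiable f 0 by case: fC => + _; apply.
pose phi := covector A (grad f 0).
have phi1 : affine_coord A phi = grad f 0.
  by rewrite -[phi]scale1r affine_coordZ// oner_eq0.
have c1 : dsubmx (A *m phi) 0 0 != 0.
  by rewrite mulmx_covector// col_mxKd mxE mulr1n oppr_eq0 oner_eq0.
have n1 : \forall psi \near phi, dsubmx (A *m psi) 0 0 != 0.
  rewrite dsubmx_pairing in c1.
  have : \forall psi \near phi, pairing (row (rshift d 0) A) psi != 0.
    exact: (cvgr_neq0 _ (@continuous_pairing R d _ phi)).
  by apply: filterS => psi; rewrite dsubmx_pairing.
have n2 : \forall psi \near phi, exists2 x, U x & grad f x = affine_coord A psi.
  have ca := differentiable_continuous (differentiable_affine_coord c1).
  by have := grad_open oU U0 fC cf (det0 _ U0); rewrite -phi1 => /ca; exact.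
have [s s0 /(dual_cone_covector cc)[s' [y [s'0 Oy E]]]] :
    exists2 s, s != 0 & dual_cone C (s *: phi).
  apply: proj_dual_cone_interior => //; first exact: covector_neq0.
  by apply: filterS (filterI n1 n2) => psi [] /(supporting_covector CK gr fC); apply.
exists y; split => //.
have := tangent_graph gr U0 df; rewrite f0.
rewrite (_ : row_mx 0 0%:M = 0); last by rewrite -scalemx1 scale0r row_mx0.
rewrite mul0mx addr0 => ->; apply/seteqP; split => v /= vy.
  have := pairingZr v s phi; rewrite vy mulr0 E pairingZr => /eqP.
  by rewrite mulf_eq0 gt_eqF// => /eqP.
have := pairingZr v s phi; rewrite E pairingZr vy mulr0 => /esym/eqP.
by rewrite mulf_eq0 (negPf s0) => /eqP.
Qed.

Lemma gauss_mapP A0 Omega K P :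
  (exists y, dual_domain Omega y /\
    tangent (boundary K) P = [set v | pairing v (covector A0 y) = 0]) ->
  dual_domain Omega (gauss_map A0 Omega K P) /\
  tangent (boundary K) P =
    [set v | pairing v (covector A0 (gauss_map A0 Omega K P)) = 0].
Proof. exact: (@getPex _ [set y | _]). Qed.

Lemma differentiable_covector A y : differentiable (@covector R d A) y.
Proof.
apply: differentiable_mxE => i j.
rewrite (_ : (fun z => _) = fun z =>
    dot z (hcoord A (delta_mx 0 i)) - vcoord A (delta_mx 0 i)).
  apply: differentiableB; last exact: differentiable_cst.
  exact: differentiable_dotl.
by apply/funext => z; rewrite dotC -pairing_covector (ord1 j) /pairing -rowE [RHS]mxE.
Qed.

(** In a chart with frame A, the Gauss map is the gradient followed by the change of affine
    coordinates on forms from A to A0. This is [gamma], differentiable since f is of class C^2; G is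
    [hcoord] followed by its Jacobian at 0. *)
Lemma gauss_map_curve K A0 Omega P : A0 \in unitmx ->
  locally_uniformly_convex (boundary K) -> boundary K P ->
  (forall Q, boundary K Q -> tangent (boundary K) Q =
    [set v | pairing v (covector A0 (gauss_map A0 Omega K Q)) = 0]) ->
  exists G : 'M[R]_(d + 1, d), forall (g : R -> V) v, g 0 = P ->
    (\forall t \near (0 : R), boundary K (g t)) -> is_derive (0 : R) 1 g v ->
    is_derive (0 : R) 1 (gauss_map A0 Omega K \o g) (v *m G).
Proof.
move=> uA0 luc bP gaussP.
have [A [U [f [gr' fC cU cf det0]]]] := luc _ bP.
have [W [gr WP U0 f0]] := graph_at_chart bP gr'.
have [uA oU _ _] := gr.
have df x : U x -> differentiable f x by case: fC => + _; apply.
have scale_covector x : U x -> exists2 s, s != 0 &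
    covector A (grad f x) =
      s *: covector A0 (gauss_map A0 Omega K (P + row_mx x (f x)%:M *m A)).
  move=> Ux; have [bQ _] := graph_mem gr Ux.
  apply: covector_ker => //; first exact: covector_neq0.
  by rewrite -gaussP// (tangent_graph gr Ux (df _ Ux)).
pose gamma x := affine_coord A0 (covector A (grad f x)).
have gammaE x : U x -> gamma x = gauss_map A0 Omega K (P + row_mx x (f x)%:M *m A).
  by move=> /scale_covector [s s0 E]; rewrite /gamma E affine_coordZ.
have dgamma : differentiable gamma 0.
  apply: (@differentiable_comp _ _ _ _ (fun x => covector A (grad f x)) (affine_coord A0)).
    apply: (@differentiable_comp _ _ _ _ (grad f) (covector A)).
      exact: (differentiable_grad fC).
    exact: differentiable_covector.
  have [s s0 ->] := scale_covector _ U0; apply: differentiable_affine_coord.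
  rewrite -scalemxAr mulmx_covector// scale_col_mx col_mxKd.
  by rewrite !mxE mulr1n mulrN1 oppr_eq0.
exists (lsubmx (invmx A) *m jacobian gamma 0) => g v g0 Sg dg.
have h0 : hcoord A (g 0 - P) = 0 by rewrite g0 subrr /hcoord mul0mx.
have dh := is_derive_hcoord A P dg.
have dg0 : differentiable gamma (hcoord A (g 0 - P)) by rewrite h0.
have := is_derive_comp_diff dg0 dh.
rewrite deriveEjacobian// h0 mulmxA => D.
apply: near_eq_is_derive D.
have Wg : W (g 0) by rewrite g0.
apply: filterS (graph_curve gr Wg Sg dg) => t [Ut gt] /=.
by rewrite gammaE// -gt.
Qed.

(** P is replaced by a Q in K so close that P + v - Q is still in the open cone. *)
Lemma open_cone_closure C K P v : open C -> [set x + c | x in K & c in C] = K ->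
  closure K P -> C v -> K (P + v).
Proof.
move=> oC KC clP Cv.
have cv : {for P, continuous (fun Q : V => P + v - Q)}.
  apply: differentiable_continuous; apply: differentiableB => //.
have : nbhs (P + v - P) C by rewrite addrAC subrr add0r; exact: open_nbhs_nbhs.
move=> /cv /clP [Q [KQ CQ]]; rewrite -KC; exists Q => //; exists (P + v - Q) => //.
by rewrite addrC subrK.
Qed.

(* K contains P + t v for a v in C at the same height as w above the tangent
   hyperplane.  If P + t w were not in K, the segment joining these two points
   would meet boundary K at a distance of order t from the tangent hyperplane,
   while boundary K is o(t)-close to it. *)
Lemma transverse_inside C K A0 Omega P y w : open C -> convex_cone C ->
  C_convex_domain C K -> cone_coordinates C A0 Omega ->
  locally_uniformly_convex (boundary K) -> boundary K P ->
  tangent (boundary K) P = [set v | pairing v (covector A0 y) = 0] ->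
  pairing w (covector A0 y) < 0 ->
  \forall t \near (0 : R)^'+, K (P + t *: w).
Proof.
move=> oC [_ sC] CK cc luc bP TE wy.
have [[_ oK cK] KC _ _] := CK.
have [clP _] := boundary_openP oK bP.
have [detA [oO cO bO O0] CE] := cc.
have uA0 : A0 \in unitmx by rewrite unitmxE detA unitr1.
pose v : V := (- pairing w (covector A0 y)) *: (row_mx 0 1%:M *m A0).
have Cv : C v.
  apply: sC; last by rewrite oppr_gt0.
  by rewrite CE; exists 0, 1; rewrite scale1r.
have vy : pairing v (covector A0 y) = pairing w (covector A0 y).
  rewrite pairingZl [X in _ * X]pairing_covector hcoordK// vcoordK//.
  by rewrite {1}/dot mul0mx mxE sub0r mulrN1 opprK.
have [A [U [f [gr' fC cU cf det0]]]] := luc _ bP.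
have [W [gr WP U0 f0]] := graph_at_chart bP gr'.
have [uA oU _ _] := gr.
have df : differentiable f 0 by case: fC => + _; apply.
have TE' := tangent_graph gr U0 df.
rewrite f0 (_ : row_mx 0 0%:M = 0) in TE'; last by rewrite -scalemx1 scale0r row_mx0.
rewrite mul0mx addr0 TE in TE'.
pose phi := covector A (grad f 0).
have [s s0 phiE] : exists2 s, s != 0 & phi = s *: covector A0 y.
  by apply: covector_ker => //; exact: covector_neq0.
pose u : V := w - v.
have up : pairing u phi = 0.
  by rewrite phiE pairingZr /u pairingDl pairingNl vy subrr mulr0.
have vp : pairing v phi != 0 by rewrite phiE pairingZr mulf_neq0// vy lt_eqF.
(* M exceeds |v + a u| for all a in [0, 1]. The contact bound at P + t z is then below t |<v, phi>|
   / 2, while the pairing there has absolute value t |<v, phi>|. *)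
pose M := `|v| + `|u| + 1.
have M0 : 0 < M by rewrite ltr_wpDl// addr_ge0.
have e0 : 0 < `|pairing v phi| / (2 * M) by rewrite divr_gt0 ?normr_gt0// mulr_gt0.
have /nbhs_ballP[r /= r0 rP] := graph_tangent_o gr WP U0 f0 df e0.
near=> t; apply: contrapT => Kt.
have t0 : 0 < t by [].
have Kv : K (P + t *: v) by apply: (open_cone_closure oC KC clP); exact: sC.
have [] := @boundary_segment R d K (P + t *: v) (t *: u) oK Kv.
  by rewrite -addrA -scalerDr [v + _]addrC subrK.
move=> a [/andP[a0 a1] bQ].
pose z : V := v + a *: u.
have QE : P + t *: v + a *: (t *: u) = P + t *: z.
  by rewrite -[LHS]addrA; congr (_ + _); rewrite /z [RHS]scalerDr !scalerA [a * t]mulrC.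
rewrite QE in bQ.
have zM : `|z| < M.
  rewrite /M ltr_pwDr// (le_trans (ler_normD _ _))// lerD2l normrZ ger0_norm//.
  by rewrite ler_piMl.
have : `|pairing (P + t *: z - P) phi| <= `|pairing v phi| / (2 * M) * `|P + t *: z - P|.
  apply: rP => //; rewrite -ball_normE /= opprD addrA subrr sub0r normrN normrZ.
  rewrite gtr0_norm//; apply: (@lt_le_trans _ _ (t * M)); first by rewrite ltr_pM2l.
  rewrite -ler_pdivlMr//; near: t; apply: nbhs_right_le; exact: divr_gt0.
rewrite addrAC subrr add0r pairingZl pairingDl pairingZl up mulr0 addr0.
rewrite normrM normrZ mulrCA ler_pM2l ?normr_gt0 ?gt_eqF//.
rewrite leNgt => /negP; apply.
rewrite mulrAC ltr_pdivrMr ?mulr_gt0// ltr_pM2l ?normr_gt0//.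
by rewrite (lt_trans zM)// ltr_pMl// ltr1n.
Unshelve. all: by end_near. Qed.

End GaussMap.

(** * Frames of a hyperplane and their determinants *)

Section Algebra.
Context {R : realType} {d : nat}.
Local Notation V := 'rV[R]_(d + 1).
Implicit Types (A B : 'M[R]_(d + 1)) (y z : 'rV[R]_d) (omega : 'rV[R]_d -> R).

(** The rows (e_i, y_i) form a basis of the kernel of [covector A y] in which the coordinates of a
    vector are its horizontal part. *)
Definition hyperplane_frame A y : 'M[R]_(d, d + 1) := row_mx 1%:M y^T *m A.

Lemma mulmx_hyperplane_frame A y m (Z : 'M[R]_(m, d)) :
  Z *m hyperplane_frame A y = row_mx Z (Z *m y^T) *m A.
Proof. by rewrite /hyperplane_frame mulmxA mul_mx_row mulmx1. Qed.

Lemma hyperplane_frameK A y : A \in unitmx ->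
  hyperplane_frame A y *m lsubmx (invmx A) = 1%:M.
Proof. by move=> uA; rewrite mulmx_lsub mulmxK// row_mxKl. Qed.

Lemma hyperplane_frameE A y m (E : 'M[R]_(m, d + 1)) : A \in unitmx ->
  (forall i, pairing (row i E) (covector A y) = 0) ->
  E = (E *m lsubmx (invmx A)) *m hyperplane_frame A y.
Proof.
move=> uA H; rewrite mulmx_hyperplane_frame.
have -> : E *m lsubmx (invmx A) *m y^T = E *m rsubmx (invmx A).
  apply/matrixP => i j; rewrite ord1; have := H i.
  rewrite pairing_covector /dot /hcoord /vcoord -!row_mul !mxE => /eqP.
  rewrite subr_eq0 => /eqP <-; apply: eq_bigr => k _; by rewrite !mxE.
by rewrite mulmx_lsub mulmx_rsub hsubmxK mulmxKV.
Qed.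

Lemma frame_coord_det A y (E : 'M[R]_(d, d + 1)) : A \in unitmx ->
  (forall i, pairing (row i E) (covector A y) = 0) -> row_free E ->
  \det (E *m lsubmx (invmx A)) != 0.
Proof.
move=> uA H fE; rewrite -unitfE -unitmxE -row_free_unit /row_free eqn_leq rank_leq_row.
move: fE; rewrite /row_free => /eqP {1}<-.
by rewrite [in X in (X <= _)%N](hyperplane_frameE uA H) mxrankM_maxl.
Qed.

(** The last row is z (1, y^T) - w (0, 1) in the basis A, so the matrix factors into a block lower
    triangular one, a unipotent one and A. *)
Lemma det_frame_normal A y (B : 'M[R]_d) z (w : R) : \det A = 1 ->
  \det (col_mx (B *m hyperplane_frame A y)
    (row_mx z (dot z y - w)%:M *m A)) = \det B * (- w).
Proof.
move=> dA.
have -> : col_mx (B *m hyperplane_frame A y) (row_mx z (dot z y - w)%:M *m A) =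
    block_mx B 0 z (- w)%:M *m block_mx 1%:M y^T 0 1%:M *m A.
  rewrite mulmx_block !mulmx1 !mulmx0 !addr0.
  rewrite mulmx_hyperplane_frame -mul_col_mx; congr (_ *m _).
  rewrite /block_mx; congr col_mx; congr row_mx.
  apply/matrixP => i j; rewrite !ord1 mxE mulr1n [RHS]mxE; congr (_ + _).
  by rewrite mxE mulr1n.
rewrite !det_mulmx dA mulr1 det_ublock !det1 !mulr1 det_lblock.
by rewrite det_scalar expr1.
Qed.

End Algebra.

(** * Differential of the affine sphere parametrisation *)

Section AffineSphere.
Context {R : realType} {d : nat}.
Local Notation V := 'rV[R]_(d + 1).
Implicit Types (A : 'M[R]_(d + 1)) (y z : 'rV[R]_d) (omega : 'rV[R]_d -> R).

(** In the derivative of <grad omega, y> - omega, the term <grad omega, dy> cancels with the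
    derivative of omega. What remains lies in the kernel of [covector A y]. *)
Lemma affine_sphere_map_curve A U omega (g : R -> 'rV[R]_d) w :
  class_C 2 U omega -> U (g 0) -> is_derive (0 : R) 1 g w ->
  is_derive (0 : R) 1 (affine_sphere_map A omega \o g)
    (w *m hessian omega (g 0) *m hyperplane_frame A (g 0)).
Proof.
move=> oC Uy dg.
have dgr := differentiable_grad oC Uy.
have dom : differentiable omega (g 0) by case: oC => + _; apply.
have := is_derive_comp_diff dgr dg; rewrite derive_hessian// => d1.
have := is_derive_comp_diff dom dg; rewrite derive_grad// => d2.
have d3 := is_derive_dot d1 dg.
have := is_derive_mulmxr A (is_derive_row_mx d1 (is_deriveB d3 d2)).
rewrite mulmx_hyperplane_frame => D; apply: (is_derive_eq D).
congr (row_mx _ _ *m _); rewrite /= dotC [dot w _]dotC addrK dotC.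
by rewrite /dot -mx11_scalar.
Qed.

(** This turns omega < 0 into the transversality and the inward direction of N. *)
Lemma pairing_affine_sphere_map A omega y : A \in unitmx ->
  pairing (affine_sphere_map A omega y) (covector A y) = omega y.
Proof.
move=> uA; rewrite pairing_covector /affine_sphere_map hcoordK// vcoordK//.
by rewrite opprB addrC subrK.
Qed.

Lemma diff_alongZ (S : set V) (F : V -> V) P L (c : R) : 0 < c ->
  diff_along S F P L -> diff_along S (fun Q => c *: F Q) P (c *: L).
Proof.
move=> c0 /eqoP H; apply/eqoP => e e0.
have ec : 0 < e / c by rewrite divr_gt0.
move: (H _ ec); apply: filterS => Q.
rewrite -scalemxAr -!scalerBr normrZ gtr0_norm// => HQ.
by rewrite -ler_pdivlMl// mulrA [c^-1 * _]mulrC.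
Qed.

End AffineSphere.

(** * Differential of N, second form and volumes at one point *)

Section AtPoint.
Context {R : realType} {d : nat}.
Local Notation V := 'rV[R]_(d + 1).
Context (S : set V) (P : V) (A : 'M[R]_(d + 1)) (U : set 'rV[R]_d)
  (omega : 'rV[R]_d -> R) (gauss : V -> 'rV[R]_d)
  (G : 'M[R]_(d + 1, d)) (kappa : R)
  (uA : A \in unitmx) (omegaC : class_C 2 U omega) (gaussU : U (gauss P))
  (tangentE : forall Q, S Q ->
    tangent S Q = [set v | pairing v (covector A (gauss Q)) = 0])
  (SP : S P)
  (gauss_curve : forall (g : R -> V) v, g 0 = P ->
    (\forall t \near (0 : R), S (g t)) -> is_derive (0 : R) 1 g v ->
    is_derive (0 : R) 1 (gauss \o g) (v *m G)).

Local Notation y := (gauss P).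
Local Notation N := (affine_sphere_map A omega \o gauss).

Lemma diff_affine_sphere_map L X : diff_along S N P L -> tangent S P X ->
  X *m L = X *m G *m hessian omega y *m hyperplane_frame A y.
Proof.
move=> NL [g [g0 Sg dg]].
have NL0 : diff_along S N (g 0) L by rewrite g0.
have [_ D1] := diff_along_curve NL0 Sg dg.
have dG := gauss_curve g0 Sg dg.
have gU : U ((gauss \o g) 0) by rewrite /= g0.
have [_ D2] := affine_sphere_map_curve A omegaC gU dG.
by rewrite -D1; apply: etrans D2 _; rewrite /= g0.
Qed.

Lemma tangent_frame_row E : tangent_frame S P E ->
  row_free E /\ forall i, pairing (row i E) (covector A y) = 0.
Proof.
move=> [fE TE]; split => // i; have : tangent S P (row i E).
  by rewrite TE /= row_sub.
by rewrite tangentE.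
Qed.

Lemma tangent_hyperplane_frame i : tangent S P (row i (hyperplane_frame A y)).
Proof.
rewrite tangentE//= rowE mulmx_hyperplane_frame pairing_covector.
have -> : delta_mx 0 i *m y^T = (dot (delta_mx 0 i) y)%:M :> 'M[R]_1.
  by rewrite [LHS]mx11_scalar.
by rewrite hcoordK// vcoordK// subrr.
Qed.

(** The endomorphism dN has matrix M in the given frame E, and dy times the Hessian in the
    hyperplane frame. The two are conjugate by the matrix B of E in the latter. *)
Lemma det_gauss : tangential_det S N P kappa ->
  \det (hyperplane_frame A y *m G) * \det (hessian omega y) = kappa.
Proof.
move=> [L [E [M [NL fE EL <-]]]].
have [freeE tE] := tangent_frame_row fE.
pose B := E *m lsubmx (invmx A).
have B0 : \det B != 0 by exact: (frame_coord_det uA tE freeE).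
have EE : E = B *m hyperplane_frame A y by exact: hyperplane_frameE.
have HL : hyperplane_frame A y *m L =
    hyperplane_frame A y *m G *m hessian omega y *m hyperplane_frame A y.
  apply/row_matrixP => i.
  by have := diff_affine_sphere_map NL (tangent_hyperplane_frame i); rewrite -!row_mul.
have : B *m (hyperplane_frame A y *m G *m hessian omega y) = M *m B.
  rewrite -[LHS]mulmx1 -(hyperplane_frameK y uA) mulmxA -[B *m _ *m _]mulmxA.
  rewrite -HL mulmxA -EE EL EE !mulmxA -[RHS]mulmx1.
  by rewrite -[in RHS](hyperplane_frameK y uA) !mulmxA.
move=> /(congr1 determinant); rewrite !det_mulmx [RHS]mulrC.
exact: mulfI.
Qed.

(** The form sending X and Z to <dy(X), horizontal part of Z> / w, extended from the tangent
    hyperplane to the whole space. *)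
Definition blaschke_form (w : R) : 'M[R]_(d + 1) :=
  w^-1 *: (G *m (lsubmx (invmx A))^T).

Lemma second_form_blaschke xi : pairing (xi P) (covector A y) != 0 ->
  second_form S xi P (blaschke_form (- pairing (xi P) (covector A y))).
Proof.
move=> xi0 Y L YT YL X TX; rewrite tangentE//=.
have [g [g0 Sg dg]] := TX.
have YL0 : diff_along S Y (g 0) L by rewrite g0.
have dY := diff_along_curve YL0 Sg dg.
have dG := gauss_curve g0 Sg dg.
have dh := is_derive_mulmxr (lsubmx (invmx A)) dY.
have dv := is_derive_coord 0 (is_derive_mulmxr (rsubmx (invmx A)) dY).
have D := is_deriveB (is_derive_dot dh dG) dv.
(* Tangency of Y along the curve says that its pairing with the moving covector vanishes near 0, so
   the product rule expression D is zero. *)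
have Z : \forall t \near (0 : R), (fun=> 0 : R) t =
    ((fun s => dot ((Y \o g) s *m lsubmx (invmx A)) ((gauss \o g) s)) -
      (fun s => ((Y \o g) s *m rsubmx (invmx A)) 0 0)) t.
  apply: filterS Sg => t St; have := YT _ St.
  by rewrite tangentE//= pairing_covector /hcoord /vcoord => <-.
have [_ D1] := near_eq_is_derive Z (is_derive_cst (0 : R) (0 : R) 1).
have [_] := D; rewrite D1 /= g0 => E.
rewrite pairingDl pairingNl pairingZl [X in X - _]pairing_covector.
rewrite /blaschke_form -scalemxAr -scalemxAl [X in X * _]mxE invrN mulNr mulNr.
rewrite opprK mulrAC mulVf// mul1r.
have -> : (X *m (G *m (lsubmx (invmx A))^T) *m (Y P)^T) 0 0 =
    dot (X *m G) (hcoord A (Y P)).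
  by rewrite /dot /hcoord trmx_mul !mulmxA.
by rewrite /hcoord /vcoord addrAC [X in _ = X]E; congr (_ + _ - _); rewrite dotC.
Qed.

(** Passing from the hyperplane frame to E contributes the same determinant once for each argument
    of the form, hence its square. The volume of E with the normal vector carries it once. *)
Lemma det_blaschke_form E w : tangent_frame S P E ->
  \det (E *m blaschke_form w *m E^T) =
  w^-1 ^+ d * (\det (E *m lsubmx (invmx A)) ^+ 2 *
    \det (hyperplane_frame A y *m G)).
Proof.
move=> fE; have [freeE tE] := tangent_frame_row fE.
rewrite /blaschke_form -scalemxAr -scalemxAl detZ; congr (_ * _).
have -> : E *m (G *m (lsubmx (invmx A))^T) *m E^T =
    (E *m G) *m (E *m lsubmx (invmx A))^T by rewrite trmx_mul !mulmxA.
rewrite det_mulmx det_tr {1}(hyperplane_frameE uA tE) -mulmxA det_mulmx.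
by rewrite expr2 mulrAC.
Qed.

Lemma det_frame_affine_sphere_map E c : \det A = 1 -> tangent_frame S P E ->
  \det (col_mx E (c *: N P)) =
  \det (E *m lsubmx (invmx A)) * - (c * omega y).
Proof.
move=> dA fE; have [freeE tE] := tangent_frame_row fE.
rewrite {1}(hyperplane_frameE uA tE) /= /affine_sphere_map scalemxAl scale_row_mx.
by rewrite scale_scalar_mx mulrBr -dotZl det_frame_normal.
Qed.

End AtPoint.

(** * The affine Gaussian curvature *)

Theorem theorem4 (R : realType) (d : nat) (C K : set 'rV[R]_(d + 1))
    (kappa : R) :
  (2 <= d)%N ->
  open C -> convex_cone C -> proper_cone C ->
  convex_domain K -> C2_hypersurface (boundary K) ->
  0 < kappa -> constant_C_curvature C K kappa ->
  constant_affine_gauss_curvature K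
    (kappa `^ (2 * (d%:R + 1) / (d%:R + 2))).
Proof.
move=> _ oC coneC [C0 _] _ _ k0 [luc CK [A [Om [omega [cc [sm _ om0 MA _] tdet]]]]].
have [dA _ _] := cc.
have uA : A \in unitmx by rewrite unitmxE dA unitr1.
have dir P (bP : boundary K P) := gauss_mapP (tangent_direction oC C0 CK cc luc bP).
pose gauss := gauss_map A Om K.
have gaussO P : boundary K P -> dual_domain Om (gauss P) by move=> /dir[].
have tangentE P : boundary K P -> tangent (boundary K) P =
  [set v | pairing v (covector A (gauss P)) = 0] by move=> /dir[].
pose c := kappa `^ (d%:R + 2)^-1.
have c0 : 0 < c by exact: powR_gt0.
have d2 : d%:R + 2 = (d + 2)%:R :> R by rewrite natrD.
have ck : c ^+ (d + 2) = kappa.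
  rewrite -powR_mulrn; last exact: ltW.
  by rewrite -powRrM d2 mulVf ?pnatr_eq0 ?addn2// powRr1// ltW.
have cdk : c ^+ d * kappa = kappa `^ (2 * (d%:R + 1) / (d%:R + 2)).
  rewrite -{1}ck -exprD -powR_mulrn; last exact: ltW.
  have -> : (d + (d + 2))%:R = 2 * (d%:R + 1) :> R.
    by rewrite addnA addnn -mul2n natrD natrM mulrDr mulr1.
  by rewrite -powRrM [_^-1 * _]mulrC.
pose xi := fun Q => c *: (affine_sphere_map A omega \o gauss) Q.
split => //; exists xi; split; last first.
  move=> P bP.
  have [L [E [M [NL fE EL detM]]]] := tdet _ bP.
  exists (c *: L), E, (c *: M); split => //; first exact: diff_alongZ.
    by rewrite -scalemxAr EL scalemxAl.
  by rewrite detZ detM.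
move=> /= P bP.
have xiP : pairing (xi P) (covector A (gauss P)) = c * omega (gauss P).
  by rewrite pairingZl pairing_affine_sphere_map.
have xi_neg : pairing (xi P) (covector A (gauss P)) < 0.
  by rewrite xiP pmulr_rlt0// om0//; exact: gaussO.
have [G GP] := gauss_map_curve uA luc bP tangentE.
have omC := sm 2.
split.
- by rewrite tangentE//= => E; rewrite E ltxx in xi_neg.
- exact: (transverse_inside oC coneC CK cc luc bP (tangentE _ bP)).
- have [L [E [M [NL fE EL detM]]]] := tdet _ bP.
  exists (c *: L); split; first exact: diff_alongZ.
  have [_ TE] := fE; move=> X; rewrite TE /= => /submxP[B ->].
  by rewrite -mulmxA -scalemxAr EL scalemxAl mulmxA submxMl.
exists (blaschke_form A G (- pairing (xi P) (covector A (gauss P)))); split.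
  by apply: (second_form_blaschke tangentE bP GP); rewrite lt_eqF.
move=> E fE.
rewrite (det_frame_affine_sphere_map _ uA tangentE bP c dA fE).
rewrite (det_blaschke_form _ uA tangentE bP _ fE).
have dG := det_gauss uA omC (gaussO _ bP) tangentE bP GP (tdet _ bP).
set w := - (c * omega (gauss P)); rewrite xiP -/w.
have o0 : 0 < - omega (gauss P) by rewrite oppr_gt0 om0//; exact: gaussO.
have w0 : 0 < w by rewrite /w -mulrN mulr_gt0.
(* With w = c (- omega) and c^(d + 2) = kappa, this is det dy = kappa (- omega)^(d + 2), obtained by
   dividing det dN by the Monge-Ampere value of the Hessian determinant. *)
have detG : \det (hyperplane_frame A (gauss P) *m G) = w ^+ (d + 2).
  rewrite /w -mulrN exprMn ck -dG (MA _ (gaussO _ bP)) -mulrA mulVf ?mulr1//.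
  by rewrite expf_neq0// gt_eqF.
(* The factor w^(-d) of the form leaves w^2, so the radicand is the square of the frame volume. *)
rewrite detG exprD mulrCA [w^-1 ^+ d * _]mulrA -exprMn mulVf ?gt_eqF//.
by rewrite expr1n mul1r -exprMn sqrtr_sqr.
Qed.
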